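(* Suppose that for every free group $F$ of finite rank and every non-trivial $w\in F$, with $X$ the presentation complex of $F/\langle\langle w\rangle\rangle$, the supremum of the quantity \[ \frac{\tau(Y)}{\deg(f)} \] over all essential maps $f:Y\to X$ from irreducible finite 2-complexes $Y$ is equal to $2-\pi(w)$. Then for every free group $F$ and every non-trivial element $w$ of the commutator subgroup $[F,F]$, \[ 2\operatorname{scl}(w)\geq\pi(w)-1 . \]
   Context: Complexes. Graphs are oriented: a graph has sets $V,E$ of vertices and edges and maps $\iota,\tau:E\to V$; morphisms preserve $\iota,\tau$. A morphism of graphs is an immersion if any two distinct edges with the same $\iota$ or with the same $\tau$ have distinct images. A cycle is a finite connected graph in which each vertex is incident to exactly two edge-ends. A 2-complex $X=(G_X,S_X,w_X)$ consists of a graph $G_X$ (the 1-skeleton), a disjoint union $S_X$ of cycles (whose components are the faces) and an immersion $w_X:S_X\to G_X$ (the attaching map). Complexes are non-empty. A morphism $f:Y\to X$ is a pair of graph morphisms $G_Y\to G_X$, $S_Y\to S_X$ commuting with the attaching maps, such that each component $C$ of $S_Y$ maps to its image component as a covering, of degree $\deg_C(f)$; set $\deg(f)=\sum_C\deg_C(f)$. The total curvature is $\tau(Y):=\deg(f)+\chi(G_Y)$. The presentation complex of $F/\langle\langle w\rangle\rangle$ ($w$ cyclically reduced) has 1-skeleton the rose with one petal per basis element of $F$, and a single face attached along the cyclic word $w$. Essential maps. Let $f:Y\to X$ be a morphism of finite complexes. By Stallings folding, $G_Y\to G_X$ factors as $G_Y\to G_{\bar Y}\to G_X$, a finite composition of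 ($\pi_1$-surjective) folds followed by an immersion. Let $S_{\bar Y}$ be the image of $S_Y$ in the fibre product $G_{\bar Y}\times_{G_X}S_X$. The map $f$ is face-essential if $S_Y\to S_{\bar Y}$ is a bijection. It is essential if, in addition, it is injective on the fundamental group of the 1-skeleton of each connected component of $Y$. Irreducibility. The Whitehead graph of a vertex $v$ of $X$ has as vertices the edge-ends of $G_X$ at $v$ (a loop contributes two) and as edges the elements $u\in w_X^{-1}(v)$, where $u$ joins the images of the two edge-ends of $S_X$ at $u$. A finite complex is visibly irreducible if: no component is a point; no vertex of the 1-skeleton has valence 1; no edge $e$ has $\#w_X^{-1}(e)=1$; every Whitehead graph of a vertex is connected, and stays connected on removing any one of its vertices. A fold of graphs identifies exactly two distinct edges $e_1,e_2$ with $\iota(e_1)=\iota(e_2)$ or $\tau(e_1)=\tau(e_2)$; it is essential if injective on fundamental groups. A finite complex $X$ is irreducible if there is a visibly irreducible complex $X'$ and a morphism $X'\to X$ that is bijective on faces (an isomorphism $S_{X'}\to S_X$) and is a finite composition of essential folds on 1-skeleta. Invariants of $w$. $\pi(w)$ (primitivity rank) is the minimal rank of a subgroup $K\le F$ that contains $w$ and in which $w$ is not primitive (not an element of a free basis of $K$), with $\pi(w)=\infty$ if there is no such $K$; the supremum of the empty set is $-\infty$. For $g\in[F,F]$, $\operatorname{cl}(g)$ is the minimal number of commutators with product $g$, and $\operatorname{scl}(g)=\inf_{n\ge1}\operatorname{cl}(g^n)/n$. *)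

(* Defs.v *)
From Stdlib Require Import Relation_Operators.
From mathcomp Require Import all_boot all_order all_algebra.
From mathcomp Require Import all_classical all_reals all_analysis.

Set Implicit Arguments.
Unset Strict Implicit.
Unset Printing Implicit Defensive.

Import Order.TTheory GRing.Theory Num.Theory.

Local Open Scope classical_set_scope.
Local Open Scope ring_scope.

(* Signed letters: [(a, true)] stands for a and [(a, false)] for its inverse.
   For the edges of a graph, [(e, true)] is e traversed from its origin to its
   terminus; it also encodes the edge-end of e at its origin, and [(e, false)]
   the edge-end of e at its terminus. *)
Definition inv_letter (A : Type) (x : A * bool) : A * bool := (x.1, ~~ x.2).

Section Graphs.

Record graph := Graph {
  gV : finType;
  gE : finType;
  src : gE -> gV;
  tgt : gE -> gV
}.

Record hom (G H : graph) := Hom {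
  hV : gV G -> gV H;
  hE : gE G -> gE H;
  hom_src : forall e, src (hE e) = hV (src e);
  hom_tgt : forall e, tgt (hE e) = hV (tgt e)
}.

Definition hom_eq (G H : graph) (f g : hom G H) : Prop :=
  hV f =1 hV g /\ hE f =1 hE g.

Definition id_hom (G : graph) : hom G G :=
  @Hom G G id id (fun=> erefl) (fun=> erefl).

Lemma comp_hom_src (G H K : graph) (g : hom H K) (f : hom G H) e :
  src (hE g (hE f e)) = hV g (hV f (src e)).
Proof. by rewrite !hom_src. Qed.

Lemma comp_hom_tgt (G H K : graph) (g : hom H K) (f : hom G H) e :
  tgt (hE g (hE f e)) = hV g (hV f (tgt e)).
Proof. by rewrite !hom_tgt. Qed.

Definition comp_hom (G H K : graph) (g : hom H K) (f : hom G H) : hom G K :=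
  @Hom G K (hV g \o hV f) (hE g \o hE f) (comp_hom_src g f) (comp_hom_tgt g f).

Definition immersion (G H : graph) (f : hom G H) : Prop :=
  forall e1 e2 : gE G, e1 <> e2 ->
    src e1 = src e2 \/ tgt e1 = tgt e2 -> hE f e1 <> hE f e2.

Definition origin (G : graph) (x : gE G * bool) : gV G :=
  if x.2 then src x.1 else tgt x.1.

Definition terminus (G : graph) (x : gE G * bool) : gV G :=
  origin (inv_letter x).

Definition edge_ends (G : graph) (v : gV G) : {set gE G * bool} :=
  [set x | origin x == v]%SET.

Definition valence (G : graph) (v : gV G) : nat := #|edge_ends v|.

Definition hom_end (G H : graph) (f : hom G H) (x : gE G * bool) :
  gE H * bool := (hE f x.1, x.2).

Definition covering (G H : graph) (f : hom G H) : Prop :=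
  forall (v : gV G) (y : gE H * bool), y \in edge_ends (hV f v) ->
    exists! x : gE G * bool, x \in edge_ends v /\ hom_end f x = y.

Definition adjacent (G : graph) : rel (gV G) := fun u v =>
  [exists x : gE G * bool, (origin x == u) && (terminus x == v)].

(* A finite graph is a disjoint union of cycles exactly when each of its
   vertices is incident to exactly two edge-ends. *)
Definition union_of_cycles (G : graph) : Prop :=
  forall v : gV G, valence v = 2%N.

Definition euler_char (G : graph) : int := #|gV G|%:Z - #|gE G|%:Z.

Fixpoint is_path (G : graph) (u v : gV G) (p : seq (gE G * bool)) : Prop :=
  match p with
  | [::] => u = v
  | x :: p' => origin x = u /\ is_path (terminus x) v p'
  end.

Definition backtrack (G : graph) (u v : gV G) (p q : seq (gE G * bool)) : Prop :=
  [/\ is_path u v p, is_path u v q &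
      exists p1 p2 x, p = p1 ++ p2 /\ q = p1 ++ [:: x; inv_letter x] ++ p2].

(* Homotopy relative to the endpoints. *)
Definition homotopic (G : graph) (u v : gV G) :
    seq (gE G * bool) -> seq (gE G * bool) -> Prop :=
  clos_refl_sym_trans _ (@backtrack G u v).

(* Injectivity on the fundamental group of each connected component; all
   base points are considered. *)
Definition pi1_injective (G H : graph) (f : hom G H) : Prop :=
  forall (v : gV G) (p q : seq (gE G * bool)),
    is_path v v p -> is_path v v q ->
    homotopic (hV f v) (hV f v) (map (hom_end f) p) (map (hom_end f) q) ->
    homotopic v v p q.

(* Up to isomorphism of the target, [q] is the quotient map identifying the
   two edges [e1] and [e2]. *)
Definition is_fold (G H : graph) (q : hom G H) : Prop :=
  exists e1 e2 : gE G,
  [/\ e1 <> e2 /\ (src e1 = src e2 \/ tgt e1 = tgt e2),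
      (forall y, exists x, hV q x = y) /\ (forall y, exists x, hE q x = y),
      forall a b, hE q a = hE q b <->
        [\/ a = b, a = e1 /\ b = e2 | a = e2 /\ b = e1] &
      forall a b, hV q a = hV q b <->
        [\/ a = b,
            (a = src e1 /\ b = src e2) \/ (a = src e2 /\ b = src e1) |
            (a = tgt e1 /\ b = tgt e2) \/ (a = tgt e2 /\ b = tgt e1)]].

Definition is_essential_fold (G H : graph) (q : hom G H) : Prop :=
  is_fold q /\ pi1_injective q.

Inductive finite_composition (P : forall G H : graph, hom G H -> Prop) :
    forall G H : graph, hom G H -> Prop :=
| composition_nil (G : graph) (f : hom G G) :
    hom_eq f (id_hom G) -> finite_composition P f
| composition_cons (G H K : graph) (q : hom G H) (g : hom H K) (f : hom G K) :
    P G H q -> finite_composition P g -> hom_eq f (comp_hom g q) ->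
    finite_composition P f.

Section FibreProduct.
Variables (A B C : graph) (p : hom A C) (w : hom B C).

Definition fprodV : finType := {x : gV A * gV B | hV p x.1 == hV w x.2}.
Definition fprodE : finType := {x : gE A * gE B | hE p x.1 == hE w x.2}.

Lemma fprod_src_proof (e : fprodE) :
  hV p (src (val e).1) == hV w (src (val e).2).
Proof. by rewrite -!hom_src (eqP (valP e)). Qed.

Lemma fprod_tgt_proof (e : fprodE) :
  hV p (tgt (val e).1) == hV w (tgt (val e).2).
Proof. by rewrite -!hom_tgt (eqP (valP e)). Qed.

Definition fprod : graph := @Graph fprodV fprodE
  (fun e => exist _ (src (val e).1, src (val e).2) (fprod_src_proof e))
  (fun e => exist _ (tgt (val e).1, tgt (val e).2) (fprod_tgt_proof e)).

Variables (S : graph) (a : hom S A) (b : hom S B).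
Hypothesis pawb : hom_eq (comp_hom p a) (comp_hom w b).

Lemma fprod_mapV_proof x : hV p (hV a x) == hV w (hV b x).
Proof. by apply/eqP; exact: (proj1 pawb x). Qed.

Lemma fprod_mapE_proof x : hE p (hE a x) == hE w (hE b x).
Proof. by apply/eqP; exact: (proj2 pawb x). Qed.

Definition fprod_mapV x : gV fprod :=
  exist _ (hV a x, hV b x) (fprod_mapV_proof x).
Definition fprod_mapE x : gE fprod :=
  exist _ (hE a x, hE b x) (fprod_mapE_proof x).

Lemma fprod_map_src e : src (fprod_mapE e) = fprod_mapV (src e).
Proof. by apply/val_inj; rewrite /= !hom_src. Qed.

Lemma fprod_map_tgt e : tgt (fprod_mapE e) = fprod_mapV (tgt e).
Proof. by apply/val_inj; rewrite /= !hom_tgt. Qed.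

Definition fprod_map : hom S fprod := Hom fprod_map_src fprod_map_tgt.

End FibreProduct.

End Graphs.

Section Complexes.

(* Finite 2-complexes. *)
Record complex := Complex {
  skel : graph;
  faces : graph;
  attach : hom faces skel;
  skel_nonempty : exists v : gV skel, True;
  faces_cycles : union_of_cycles faces;
  attach_immersion : immersion attach
}.

Record cmorphism (Y X : complex) := CMorphism {
  cskel : hom (skel Y) (skel X);
  cface : hom (faces Y) (faces X);
  cmor_comm : hom_eq (comp_hom (attach X) cface) (comp_hom cskel (attach Y));
  cmor_cover : covering cface
}.

(* The degree of the covering on the component of [c], counted as the
   cardinality of a fibre. *)
Definition face_degree (Y X : complex) (f : cmorphism Y X)
    (c : gV (faces Y)) : nat :=
  #|[set u | connect (@adjacent (faces Y)) c u &
             hV (cface f) u == hV (cface f) c]%SET|.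

(* [roots] selects one vertex in each connected component. *)
Definition degree (Y X : complex) (f : cmorphism Y X) : nat :=
  (\sum_(c in roots (@adjacent (faces Y))) face_degree f c)%N.

Definition total_curvature (Y X : complex) (f : cmorphism Y X) : int :=
  (degree f)%:Z + euler_char (skel Y).

Lemma folded_comm (Y X : complex) (f : cmorphism Y X) (H : graph)
    (q : hom (skel Y) H) (p : hom H (skel X)) :
  hom_eq (cskel f) (comp_hom p q) ->
  hom_eq (comp_hom p (comp_hom q (attach Y))) (comp_hom (attach X) (cface f)).
Proof.
move=> [fV fE]; have [cV cE] := cmor_comm f.
by split=> x; [rewrite cV /= fV | rewrite cE /= fE].
Qed.

(* The Stallings factorization is unique up to isomorphism. A map is a
   bijection onto its image precisely when it is injective. *)
Definition face_essential (Y X : complex) (f : cmorphism Y X) : Prop :=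
  exists (H : graph) (q : hom (skel Y) H) (p : hom H (skel X))
         (fpq : hom_eq (cskel f) (comp_hom p q)),
    [/\ finite_composition is_fold q, immersion p &
        injective (hV (fprod_map (folded_comm fpq))) /\
        injective (hE (fprod_map (folded_comm fpq)))].

Definition essential (Y X : complex) (f : cmorphism Y X) : Prop :=
  face_essential f /\ pi1_injective (cskel f).

(* Adjacency in the Whitehead graph at [v], whose vertex set is
   [edge_ends v]. *)
Definition whitehead_rel (X : complex) (v : gV (skel X)) :
    rel (gE (skel X) * bool) := fun x y =>
  [exists u : gV (faces X), (hV (attach X) u == v) &&
    [exists s in edge_ends u, [exists t in edge_ends u,
      [&& s != t, hom_end (attach X) s == x & hom_end (attach X) t == y]]]].

Definition connected_on (T : finType) (A : {set T}) (r : rel T) : Prop :=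
  forall x y, x \in A -> y \in A ->
    connect [rel s t | [&& s \in A, t \in A & r s t]] x y.

(* A component is a point exactly when its vertex has valence 0. *)
Definition visibly_irreducible (X : complex) : Prop :=
  [/\ forall v : gV (skel X), valence v <> 0%N,
      forall v : gV (skel X), valence v <> 1%N,
      forall e : gE (skel X),
        #|[set s | hE (attach X) s == e]%SET| <> 1%N,
      forall v : gV (skel X), connected_on (edge_ends v) (whitehead_rel v) &
      forall (v : gV (skel X)) z, z \in edge_ends v ->
        connected_on (edge_ends v :\ z)%SET (whitehead_rel v)].

Definition irreducible (X : complex) : Prop :=
  exists (X' : complex) (g : cmorphism X' X),
    [/\ visibly_irreducible X',
        bijective (hV (cface g)) /\ bijective (hE (cface g)) &
        finite_composition is_essential_fold (cskel g)].

Definition irreducible_curvature (R : realType) (X : complex) : \bar R :=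
  ereal_sup [set x | exists (Y : complex) (f : cmorphism Y X),
    [/\ irreducible Y, essential f &
        x = ((total_curvature f)%:~R / (degree f)%:R)%:E]].

End Complexes.

Section PresentationComplex.

Definition cyclically_reduced (A : eqType) (n : nat)
    (u : n.-tuple (A * bool)) : Prop :=
  forall i : 'I_n, tnth u (ordS i) <> inv_letter (tnth u i).

Variables (A : finType) (n : nat) (u : n.-tuple (A * bool)).

Definition rose : graph := @Graph unit A (fun=> tt) (fun=> tt).

(* The cycle of length [n]; its edge [i] joins [i] and [i + 1 mod n] and is
   oriented so that the attaching map to the rose preserves orientations. *)
Definition word_cycle : graph := @Graph 'I_n 'I_n
  (fun i => if (tnth u i).2 then i else ordS i)
  (fun i => if (tnth u i).2 then ordS i else i).

Definition word_attach : hom word_cycle rose :=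
  @Hom word_cycle rose (fun=> tt) (fun i => (tnth u i).1)
    (fun=> erefl) (fun=> erefl).

Lemma word_cycle_valence : union_of_cycles word_cycle.
Proof.
move=> v; rewrite /valence.
pose x1 : 'I_n * bool := (v, (tnth u v).2).
pose x2 : 'I_n * bool := (ord_pred v, ~~ (tnth u (ord_pred v)).2).
have -> : edge_ends (v : gV word_cycle) = [set x1; x2]%SET.
  apply/setP=> -[i b]; rewrite !inE /origin /= /x1 /x2 !xpair_eqE.
  have Si : (ordS i == v) = (i == ord_pred v).
    by apply/eqP/eqP => [<-|->]; rewrite ?ordSK ?ord_predK.
  case: b; case E: (tnth u i).2; rewrite /= ?Si;
    do 2?[case: eqP => [iv|_] /=]; by rewrite -?iv ?E ?orbT //; case: eqP => // <-; rewrite E.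
rewrite cards2; suff -> : x1 != x2 by [].
by apply/eqP => -[e]; rewrite -e; case: (tnth u v).2.
Qed.

Hypothesis u_red : cyclically_reduced u.

Lemma word_attach_immersion : immersion word_attach.
Proof.
move=> i j /= ne ends eqa; apply: ne.
have same k : tnth u k = ((tnth u k).1, (tnth u k).2) by case: (tnth u k).
have turn k l : (tnth u k).1 = (tnth u l).1 ->
    (tnth u k).2 = ~~ (tnth u l).2 -> k <> ordS l.
  by move=> e1 e2 kl; apply: (u_red (i := l)); rewrite -kl (same k) e1 e2.
case: ends; case Ei: (tnth u i).2; case Ej: (tnth u j).2 => //.
- by move=> h; case: (turn i j) => //; rewrite Ei Ej.
- by move=> h; case: (turn j i) => //; rewrite Ei Ej.
- by move=> h; exact: (can_inj (@ordSK n) h).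
- by move=> h; exact: (can_inj (@ordSK n) h).
- by move=> h; case: (turn j i) => //; rewrite Ei Ej.
- by move=> h; case: (turn i j) => //; rewrite Ei Ej.
Qed.

Definition presentation_complex : complex :=
  @Complex rose word_cycle word_attach (ex_intro _ tt I)
    word_cycle_valence word_attach_immersion.

End PresentationComplex.

Section FreeGroups.
Variable F : groupType.

Definition word_val (I : Type) (b : I -> F) (s : seq (I * bool)) : F :=
  (\prod_(x <- s) (if x.2 then b x.1 else (b x.1)^-1))%g.

Definition reduced (I : eqType) (s : seq (I * bool)) : bool :=
  sorted [rel x y | y != inv_letter x] s.

Definition is_subgroup (K : set F) : Prop :=
  K 1%g /\ forall x y, K x -> K y -> K (x / y)%g.

(* The family [b] is a free basis of the subgroup [K]. *)
Definition free_basis (K : set F) (I : eqType) (b : I -> F) : Prop :=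
  (forall x, K x <-> exists s, x = word_val b s) /\
  (forall s, reduced s -> word_val b s = 1%g -> s = [::]).

Definition is_free : Prop := exists (I : eqType) (b : I -> F), free_basis setT b.

Definition is_primitive (K : set F) (w : F) : Prop :=
  exists (I : eqType) (b : I -> F), free_basis K b /\ exists i, b i = w.

Definition has_rank (K : set F) (n : nat) : Prop :=
  exists b : 'I_n -> F, free_basis K b.

Definition primitivity_rank (R : realType) (w : F) : \bar R :=
  ereal_inf [set x | exists (K : set F) (n : nat),
    [/\ is_subgroup K, K w, ~ is_primitive K w, has_rank K n &
        x = (n%:R)%:E]].

Definition commutator_subgroup : set F :=
  smallest is_subgroup [set g | exists x y : F, g = [~ x, y]%g].

Definition product_of_commutators (k : nat) (g : F) : Prop :=
  exists x y : 'I_k -> F, g = (\prod_(i < k) [~ x i, y i])%g.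

Definition cl (R : realType) (g : F) : \bar R :=
  ereal_inf [set x | exists k : nat,
    product_of_commutators k g /\ x = (k%:R)%:E].

Definition scl (R : realType) (g : F) : \bar R :=
  ereal_inf [set x | exists n : nat,
    (1 <= n)%N /\ x = (cl R (g ^+ n)%g * ((n%:R)^-1)%:E)%E].

End FreeGroups.

(* Main.v *)
(** A surface over the presentation complex is a finite set of sides, glued in
    pairs carrying inverse letters, such that the faces are covers of the
    relator. Its Euler characteristic is, for a fixed number of sides, controlled
    by its number of vertices, and an expression of [w ^ n] as a product of [k]
    commutators yields such a surface of degree [n] with [V - E >= - 2 k].

    Cutting and regluing at a vertex that meets the same letter of the relator
    twice increases the number of vertices, so that only finitely many types of
    vertices matter, and Dickson's lemma provides a surface with the largest
    possible ratio of vertices to sides. Such an extremal surface is essential: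
    if a reduced path of its 1-skeleton joins two occurrences of the same letter
    and has trivial image in the free group, the path becomes embedded in a finite
    cover, which is extremal too; regluing then shortens the path, and finally
    creates a vertex that meets the same letter twice. Since closed surfaces are
    visibly irreducible, the hypothesis applies to this surface and bounds the
    primitivity rank. *)

From Stdlib Require Import Relation_Operators.
From HB Require Import structures.
Require Import Defs.
From mathcomp Require Import all_boot all_fingroup.
From mathcomp Require Import zify boolp.

Set Implicit Arguments.
Unset Strict Implicit.
Unset Printing Implicit Defensive.

(** * Orbits of permutations *)

(** For a relator of length L, a surface of degree d has dL sides and dL/2 edges, so its ratio
    tau/deg = 1 + (V - E)/d grows with the number of vertices per side; this is why that quotient is
    maximized. A surface of degree n with V - E >= -2k has tau/deg >= 1 - 2k/n, and the extremal one
    does at least as well. If it is essential and irreducible, then 1 - 2k/n <= 2 - pi(w), that is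
    pi(w) - 1 <= 2k/n; the infimum of k/n over all expressions of powers of w is scl(w). The
    obstacle is essentiality: a path with trivial image can be shortened by regluing only if it is
    embedded, and making it embedded changes the degree. Extremality is therefore required against
    surfaces of all degrees, which makes it pass to finite covers. Such a maximum exists because
    surfaces correspond to integer points of a cone of finite dimension: vertex types are
    permutations of the L letters, subject to linear gluing equations. A surface is encoded by two
    permutations, so each cut and regluing is a multiplication by transpositions, and vertices are
    counted as orbits. *)

Section Orbits.
Local Open Scope group_scope.
Variable T : finType.
Implicit Types (s t : {perm T}) (x y z : T).

Lemma porbits_split s x y : x != y -> x \in porbit s y ->
  #|porbits (tperm x y * s)| = #|porbits s|.+1.
Proof.
by move=> nxy xy; have := porbits_mul_tperm s x y; rewrite /= nxy xy addn0 addn1.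
Qed.

Lemma porbits_merge s x y : x \notin porbit s y ->
  #|porbits (tperm x y * s)|.+1 = #|porbits s|.
Proof.
move=> xy; have nxy : x != y by apply: contraNneq xy => ->; exact: porbit_id.
have := porbits_mul_tperm s x y; rewrite /= nxy xy /=; lia.
Qed.

Lemma porbits_tperm_ge s x y : #|porbits s| <= #|porbits (tperm x y * s)|.+1.
Proof.
case: (eqVneq x y) => [->|nxy]; first by rewrite tperm1 mul1g.
case: (boolP (x \in porbit s y)) => [/porbits_split-> //|/porbits_merge <- //].
lia.
Qed.

Lemma mul_tperm_swap s x y : s * tperm x y = tperm (s^-1 x) (s^-1 y) * s.
Proof. by rewrite -tpermJ conjgE invgK -!mulgA mulVg mulg1. Qed.

Lemma porbit_step s x : porbit s (s x) = porbit s x.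
Proof. by rewrite -(porbit_perm s 1 x) expg1. Qed.

Lemma porbit_stepV s x : porbit s (s^-1 x) = porbit s x.
Proof. by rewrite -{2}(permKV s x) porbit_step. Qed.

Lemma porbits_splitr s x y : x != y -> x \in porbit s y ->
  #|porbits (s * tperm x y)| = #|porbits s|.+1.
Proof.
move=> nxy xy; rewrite mul_tperm_swap; apply: porbits_split.
  by rewrite (inj_eq perm_inj).
by rewrite -eq_porbit_mem !porbit_stepV eq_porbit_mem.
Qed.

Lemma porbits_merger s x y : x \notin porbit s y ->
  #|porbits (s * tperm x y)|.+1 = #|porbits s|.
Proof.
move=> xy; rewrite mul_tperm_swap; apply: porbits_merge.
by rewrite -eq_porbit_mem !porbit_stepV eq_porbit_mem.
Qed.

Lemma porbits_tpermr_ge s x y : #|porbits s| <= #|porbits (s * tperm x y)|.+1.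
Proof. by rewrite mul_tperm_swap porbits_tperm_ge. Qed.

Lemma porbits_conj s t : #|porbits (s ^ t)| = #|porbits s|.
Proof.
have E x : porbit (s ^ t) (t x) = t @: porbit s x.
  apply/setP=> y; apply/porbitP/imsetP => [[i ->]|[z /porbitP[i ->] ->]].
    by exists ((s ^+ i) x); rewrite ?mem_porbit // -conjXg permJ.
  by exists i; rewrite -conjXg permJ.
have -> : porbits (s ^ t) = (fun A : {set T} => t @: A) @: porbits s.
  apply/setP=> A; apply/imsetP/imsetP => [[x _ ->]|[_ /imsetP[x _ ->] ->]].
    by exists (porbit s (t^-1 x)); rewrite ?imset_f // -E permKV.
  by exists (t x); rewrite // E.
by rewrite card_imset //; apply: imset_inj; exact: perm_inj.
Qed.

Lemma porbit_inv (R : Type) (f : T -> R) s x y :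
  (forall z, f (s z) = f z) -> x \in porbit s y -> f x = f y.
Proof.
move=> fs /porbitP[i ->]; elim: i => [|i IH]; first by rewrite expg0 perm1.
by rewrite expgSr permM fs.
Qed.

Lemma porbit_ext s t x : {in porbit s x, s =1 t} -> porbit t x = porbit s x.
Proof.
move=> st; have E i : (t ^+ i) x = (s ^+ i) x.
  elim: i => [|i IH]; first by rewrite !expg0 perm1.
  by rewrite !expgSr !permM IH st // mem_porbit.
by apply/setP=> y; apply/porbitP/porbitP => -[i ->]; exists i; rewrite E.
Qed.

Lemma merge_joins s x y : x \notin porbit s y ->
  x \in porbit (tperm x y * s) y.
Proof.
move=> xy; have nxy : x != y by apply: contraNneq xy => ->; exact: porbit_id.
have := porbits_merge xy; have := porbits_mul_tperm (tperm x y * s) x y.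
rewrite /= mulgA tperm2 mul1g nxy; case: (x \in _) => //=; lia.
Qed.

(** Only the steps of [s] from [x] and [y] are altered, and these stay in the merged orbit; so the
    new orbit is constant along [s]. *)
Lemma merge_coarser s x y a b : x \notin porbit s y ->
  a \in porbit s b -> a \in porbit (tperm x y * s) b.
Proof.
move=> xy; rewrite -!eq_porbit_mem => /eqP ab; apply/eqP.
have := merge_joins xy; rewrite -eq_porbit_mem => /eqP Exy.
set t := _ * s in Exy *.
apply: (porbit_inv (s := s) (f := porbit t)); last by rewrite -eq_porbit_mem; apply/eqP.
move=> z; case: (eqVneq z x) => [->|nx].
  have -> : s x = t y by rewrite permM tpermR.
  by rewrite porbit_step Exy.
case: (eqVneq z y) => [->|ny].
  have -> : s y = t x by rewrite permM tpermL.
  by rewrite porbit_step Exy.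
have -> : s z = t z by rewrite permM tpermD // eq_sym.
by rewrite porbit_step.
Qed.

Lemma porbit_tperm_id s x y z : x \notin porbit s z -> y \notin porbit s z ->
  porbit (tperm x y * s) z = porbit s z.
Proof.
move=> xz yz; apply: porbit_ext => a az; rewrite permM tpermD //.
  by apply: contraNneq xz => ->.
by apply: contraNneq yz => ->.
Qed.

End Orbits.

(** * Dickson's lemma and maximal ratios *)

(** The tails have a finite basis by induction, realized with heads at most some [N]. A vector with
    head at least [N] dominates one of these; each of the finitely many slices with head below [N]
    has a basis by induction again. *)
Lemma dickson_seq n (P : seq nat -> Prop) :
  exists B : seq (seq nat), (forall b, b \in B -> P b /\ size b = n) /\
    forall x, P x -> size x = n -> exists2 b, b \in B & all2 leq b x.
Proof.
elim: n P => [|n IH] P.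
  have [P0|nP0] := EM (P [::]).
    exists [:: [::]]; split; first by move=> b; rewrite inE => /eqP->.
    by move=> x _ /size0nil->; exists [::]; rewrite ?inE.
  by exists [::]; split=> // x Px /size0nil x0; rewrite x0 in Px.
have [B1 [B1P B1c]] := IH (fun x => exists a, P (a :: x)).
have [N [B2 [B2P B2c]]] : exists N (B2 : seq (seq nat)),
    (forall b, b \in B2 -> P b /\ size b = n.+1) /\
    forall b1, b1 \in B1 -> exists2 a, a <= N & a :: b1 \in B2.
  elim: B1 B1P {B1c} => [|b B1 IHB] B1P.
    by exists 0, [::].
  have [|N [B2 [B2P B2c]]] := IHB.
    by move=> b' b'B; apply: B1P; rewrite inE b'B orbT.
  have [[a Pa] sb] := B1P b (mem_head _ _).
  exists (maxn a N), ((a :: b) :: B2); split.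
    by move=> c; rewrite inE => /orP[/eqP->|/B2P //]; rewrite /= sb.
  move=> c; rewrite inE => /orP[/eqP->|/B2c[a' a'N ca']].
    by exists a; rewrite ?leq_maxl ?mem_head.
  by exists a'; rewrite ?inE ?ca' ?orbT //; apply: leq_trans a'N (leq_maxr _ _).
have [B3 [B3P B3c]] : exists B3 : seq (seq nat),
    (forall b, b \in B3 -> P b /\ size b = n.+1) /\
    forall a x, a < N -> P (a :: x) -> size x = n ->
      exists2 b, b \in B3 & all2 leq b (a :: x).
  elim: N {B2c} => [|N [B3 [B3P B3c]]]; first by exists [::].
  have [B4 [B4P B4c]] := IH (fun x => P (N :: x)).
  exists (map (cons N) B4 ++ B3); split.
    move=> b; rewrite mem_cat => /orP[/mapP[c /B4P[Pc sc] ->]|/B3P //].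
    by rewrite /= sc.
  move=> a x; rewrite ltnS leq_eqVlt => /orP[/eqP-> Px sx|aN Px sx].
    have [b bB bx] := B4c x Px sx.
    by exists (N :: b); rewrite ?mem_cat ?map_f //= leqnn.
  by have [b bB bx] := B3c a x aN Px sx; exists b; rewrite ?mem_cat ?bB ?orbT.
exists (B2 ++ B3); split.
  by move=> b; rewrite mem_cat => /orP[/B2P|/B3P].
move=> [//|a x] Px [sx]; case: (ltnP a N) => [aN|Na].
  by have [b bB bx] := B3c a x aN Px sx; exists b; rewrite ?mem_cat ?bB ?orbT.
have [b bB bx] := B1c x (ex_intro _ a Px) sx.
have [a' a'N ba] := B2c b bB; exists (a' :: b); first by rewrite mem_cat ba.
by rewrite /= bx andbT; apply: leq_trans a'N Na.
Qed.

Lemma dickson (T : finType) (P : {ffun T -> nat} -> Prop) :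
  exists B : seq {ffun T -> nat}, (forall b, b \in B -> P b) /\
    forall x, P x -> exists2 b, b \in B & forall t, b t <= x t.
Proof.
pose h (s : seq nat) : {ffun T -> nat} := [ffun t => nth 0 s (enum_rank t)].
pose g (x : {ffun T -> nat}) := [seq x t | t <- enum T].
have gK x : h (g x) = x.
  by apply/ffunP=> t; rewrite ffunE (nth_map t) ?nth_enum_rank // -cardE.
have [B [BP Bc]] := dickson_seq #|T| (fun s => P (h s)).
exists (map h B); split; first by move=> b /mapP[c /BP[Pc _] ->].
move=> x Px; have [||b bB bx] := Bc (g x).
- by rewrite gK.
- by rewrite size_map -cardE.
exists (h b); first exact: map_f.
move=> t; rewrite -[x]gK !ffunE.
move: bx; rewrite all2E => /andP[/eqP sb /allP/= bx].
have lt_t : enum_rank t < size b by rewrite sb size_map -cardE.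
apply: (bx (nth 0 b (enum_rank t), nth 0 (g x) (enum_rank t))).
by rewrite -nth_zip // mem_nth // size_zip -sb minnn.
Qed.

(* By Dickson's lemma the cone has finitely many minimal non-zero points, and
   these generate it: the ratio is maximal at one of them. *)
Lemma max_ratio (T : finType) (M : {ffun T -> nat} -> Prop) (a b : T -> nat) :
  (forall x y, M x -> M y -> (forall t, y t <= x t) -> M [ffun t => x t - y t]) ->
  (forall t, a t <= b t) ->
  let A c (x : {ffun T -> nat}) := \sum_t x t * c t in
  (exists x, M x /\ 0 < A b x) ->
  exists x, [/\ M x, 0 < A b x &
    forall y, M y -> (0 < A b y) -> A a y * A b x <= A a x * A b y].
Proof.
move=> Msub ab A [x0 [Mx0 x0_gt0]].
have [B [BP Bc]] := dickson (fun x => M x /\ 0 < A b x).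
have [m mB mmax] : exists2 m, m \in B &
    forall y, y \in B -> A a y * A b m <= A a m * A b y.
  have [b0 b0B _] := Bc x0 (conj Mx0 x0_gt0).
  elim: B BP b0 b0B {Bc} => [//|c B IH] BP b0 _.
  case: B IH BP => [|c' B] IH BP.
    exists c; rewrite ?mem_head // => y; rewrite inE => /eqP-> //.
  have [||m mB mmax] := IH _ c'; rewrite ?mem_head //.
    by move=> y yB; apply: BP; rewrite inE yB orbT.
  have [_ c_gt0] := BP c (mem_head _ _).
  have [|_ m_gt0] := BP m; first by rewrite inE mB orbT.
  case: (leqP (A a c * A b m) (A a m * A b c)) => [le|/ltnW le].
    exists m; first by rewrite inE mB orbT.
    by move=> y; rewrite inE => /orP[/eqP->|/mmax].
  exists c; first exact: mem_head.
  move=> y; rewrite inE => /orP[/eqP-> //|yB]; have := mmax y yB => le2.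
  rewrite -(leq_pmul2r m_gt0).
  have := leq_mul (leqnn (A b c)) le2; have := leq_mul (leqnn (A b y)) le.
  lia.
have [Mm m_gt0] := BP m mB; exists m; split=> // y.
(* Descent on the sum of the coordinates: a basis vector below [y] is subtracted from [y]. *)
move: {2}(\sum_t y t).+1 (ltnSn (\sum_t y t)) => N.
elim: N y => // N IH y yN My y_gt0.
have [c cB cy] := Bc y (conj My y_gt0); have [Mc c_gt0] := BP c cB.
pose z : {ffun T -> nat} := [ffun t => y t - c t].
have Az d : A d y = A d z + A d c.
  rewrite /A -big_split /=; apply: eq_bigr => t _.
  by rewrite -mulnDl ffunE subnK.
have := mmax c cB => lec.
(* A remainder with zero denominator has zero numerator, because [a t <= b t]. *)
case: (posnP (A b z)) => [z0|z_gt0].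
  have : A a z <= A b z by apply: leq_sum => t _; rewrite leq_mul2l ab orbT.
  by rewrite !Az z0 leqn0 => /eqP->.
have : A a z * A b m <= A a m * A b z.
  apply: IH => //; last exact: Msub.
  have c_pos : 0 < \sum_t c t.
    rewrite lt0n; apply: contraTneq c_gt0 => /eqP; rewrite sum_nat_eq0.
    move=> /forallP c0; rewrite -leqNgt leqn0 sum_nat_eq0; apply/forallP=> t.
    by have /eqP-> := c0 t.
  have : \sum_t y t = \sum_t z t + \sum_t c t.
    by rewrite -big_split /=; apply: eq_bigr => t _; rewrite ffunE subnK.
  lia.
by rewrite !Az; lia.
Qed.

(** * Surfaces over a relator *)

(** Each element is matched with the element of the same rank in the class of the inverse key;
    preserving ranks makes the matching involutive. *)
Lemma matching (D : finType) (K : eqType) (k : D -> K) (inv : K -> K) :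
  involutive inv ->
  (forall h, #|[pred t | k t == h]| = #|[pred t | k t == inv h]|) ->
  exists si : {perm D}, (forall t, si (si t) = t) /\
    forall t, k (si t) = inv (k t).
Proof.
move=> invK cnt; pose cl h := enum [pred t | k t == h].
have clP h t : (t \in cl h) = (k t == h) by rewrite mem_enum inE.
pose f t := nth t (cl (inv (k t))) (index t (cl (k t))).
have f_in t : f t \in cl (inv (k t)).
  by rewrite mem_nth // -cardE -cnt cardE index_mem clP.
have kf t : k (f t) = inv (k t) by apply/eqP; rewrite -clP.
have fK : cancel f f.
  move=> t; rewrite {1}/f kf invK /f index_uniq ?enum_uniq //.
    by rewrite (set_nth_default t) ?nth_index ?clP // index_mem clP.
  by rewrite -cardE -cnt cardE index_mem clP.
exists (perm (can_inj fK)); split=> t; rewrite !permE //.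
Qed.

(** A permutation that is right off [x] is corrected at [x] by a transposition, which injectivity of
    [f] keeps away from the other values. *)
Lemma perm_extend (T : finType) (f : T -> T) (A : {set T}) :
  {in A &, injective f} -> exists s : {perm T}, {in A, s =1 f}.
Proof.
move: {2}#|A| (erefl #|A|) => n; elim: n A => [|n IH] A.
  by move=> /cards0_eq-> _; exists 1%g => x; rewrite inE.
move=> sA fA; have /card_gt0P[x xA] : 0 < #|A| by rewrite sA.
have AP y : y \in A -> y = x \/ y \in A :\ x.
  by move=> yA; case: (eqVneq y x); [left | right; rewrite !inE yA andbT].
have [||s sf] := IH (A :\ x).
- by move: sA; rewrite (cardsD1 x) xA => -[].
- by move=> y z /setD1P[_ yA] /setD1P[_ zA]; apply: fA.
exists (s * tperm (s x) (f x))%g => y /AP[->|yA]; rewrite permM ?tpermL //.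
have /setD1P[yx yA'] := yA.
have n1 : s x != s y by rewrite (inj_eq perm_inj) eq_sym.
have n2 : f x != s y by apply: contra yx; rewrite sf // => /eqP/fA->.
by rewrite tpermD // sf.
Qed.

Lemma card_ltn_ord m n : m <= n -> #|[pred j : 'I_n | j < m]| = m.
Proof.
move=> mn; have := big_ord_widen (op := addn) (idx := 0) n (fun=> 1) mn.
by rewrite !sum1_card card_ord => /esym.
Qed.

Section Surfaces.
Variables (A : eqType) (L : nat) (u : L.-tuple (A * bool)).

(* An oriented closed surface tiled by the relator: [D] is the set of sides of
   the edges, [p d] is the letter of the relator read along [d], [ph] follows
   the boundaries of the faces and [si] passes to the other side of an edge.
   Then the orbits of [si * ph] are the sets of edges leaving the vertices.
   Outside [S] nothing is attached. *)
Definition surface_on (D : finType) (S : {set D}) (p : D -> 'I_L)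
    (si ph : {perm D}) : Prop :=
  [/\ forall d, d \notin S -> si d = d /\ ph d = d,
      forall d, si (si d) = d,
      forall d, d \in S -> p (ph d) = ordS (p d) &
      forall d, d \in S -> tnth u (p (si d)) = inv_letter (tnth u (p d))].

Definition surface (D : finType) (p : D -> 'I_L) (si ph : {perm D}) : Prop :=
  [/\ forall d, si (si d) = d, forall d, p (ph d) = ordS (p d) &
      forall d, tnth u (p (si d)) = inv_letter (tnth u (p d))].

Definition nvert (D : finType) (si ph : {perm D}) : nat :=
  #|porbits (si * ph)%g|.

(* The edges leaving a vertex of a surface, when they carry distinct letters of
   the relator, form a permutation of part of the letters; the other letters
   are fixed. *)
Definition vertex_type (c : {perm 'I_L}) : Prop :=
  forall i, c i != i -> tnth u (ord_pred (c i)) = inv_letter (tnth u i).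

Definition vsize (c : {perm 'I_L}) : nat := #|[set i | c i != i]|.

(** At a vertex of type [c], a side at position [i] of the relator whose opposite side is at
    position [j]: turning around the vertex crosses the edge, then advances by one position. *)
Definition arc (c : {perm 'I_L}) (i j : 'I_L) : bool :=
  (c i != i) && (ord_pred (c i) == j).

(** The gluing equations for [x c] vertices of each type [c]: passing to the opposite side turns an
    arc [(i, j)] into an arc [(j, i)]. *)
Definition balanced (x : {ffun {perm 'I_L} -> nat}) : Prop :=
  (forall c, 0 < x c -> vertex_type c) /\
  forall i j, \sum_c x c * arc c i j = \sum_c x c * arc c j i.

Lemma inv_letterK : involutive (@inv_letter A).
Proof. by move=> [a b]; rewrite /inv_letter /= negbK. Qed.

Lemma inv_letter_neq (x : A * bool) : inv_letter x <> x.
Proof. by case: x => a [] []. Qed.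

Lemma balanced_sub x y : balanced x -> balanced y -> (forall c, y c <= x c) ->
  balanced [ffun c => x c - y c].
Proof.
move=> [xv xb] [_ yb] yx; split.
  by move=> c; rewrite ffunE => h; apply: xv; lia.
move=> i j; apply/eqP; rewrite -(eqn_add2r (\sum_c y c * arc c i j)).
rewrite {2}yb -!big_split /=; apply/eqP.
transitivity (\sum_c x c * arc c i j).
  by apply: eq_bigr => c _; rewrite ffunE -mulnDl subnK.
by rewrite xb; apply: eq_bigr => c _; rewrite ffunE -mulnDl subnK.
Qed.

Lemma neq1_vsize (c : {perm 'I_L}) : (c != 1%g) <= vsize c.
Proof.
case: eqP => //= nc; rewrite card_gt0; apply/set0Pn.
apply: contrapT => h; apply: nc; apply/permP=> i; rewrite perm1.
apply/eqP/negPn/negP => ci; apply: h; exists i; by rewrite inE.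
Qed.

Section Realization.
Variable x : {ffun {perm 'I_L} -> nat}.
Hypothesis xb : balanced x.

Let N := \sum_c x c.
Let copies : finType := ({perm 'I_L} * 'I_N * 'I_L)%type.
Let sides := {t : copies | (t.1.2 < x t.1.1) && (t.1.1 t.2 != t.2)}.

Let le_N c : x c <= N.
Proof. by rewrite /N (bigD1 c) //= leq_addr. Qed.

Let count_copies (Q : {perm 'I_L} -> pred 'I_L) :
  #|[pred t : copies | (t.1.2 < x t.1.1) && Q t.1.1 t.2]|
  = \sum_c x c * #|[pred i | Q c i]|.
Proof.
rewrite -sum1_card big_mkcond /=.
rewrite -(pair_bigA _ (fun (a : {perm 'I_L} * 'I_N) (i : 'I_L) => if (a.2 < x a.1) && Q a.1 i then 1 else 0)) /=.
rewrite -(pair_bigA _ (fun (c : {perm 'I_L}) (j : 'I_N) => \sum_i if (j < x c) && Q c i then 1 else 0)) /=.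
apply: eq_bigr => c _.
transitivity (\sum_(j < N | j < x c) #|[pred i | Q c i]|).
  rewrite [RHS]big_mkcond; apply: eq_bigr => j _; case: (j < x c) => /=.
    by rewrite -sum1_card [RHS]big_mkcond.
  by rewrite big1.
by rewrite sum_nat_const (card_ltn_ord (le_N c)).
Qed.

Let count_sides (Q : {perm 'I_L} -> pred 'I_L) :
  #|[pred t : sides | Q (val t).1.1 (val t).2]|
  = \sum_c x c * #|[pred i | (c i != i) && Q c i]|.
Proof.
rewrite -count_copies -(card_image (@val_inj _ _ sides)); apply: eq_card => t.
rewrite inE; apply/imageP/idP => [[s Qs ->]|].
  by rewrite andbA (valP s).
by rewrite andbA => /andP[Pt Qt]; exists (Sub t Pt).
Qed.

Let next_copy (t : copies) : copies := (t.1, t.1.1 t.2).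

Let psi_proof (t : sides) :
  ((next_copy (val t)).1.2 < x (next_copy (val t)).1.1) &&
  ((next_copy (val t)).1.1 (next_copy (val t)).2 != (next_copy (val t)).2).
Proof.
have /andP[h1 h2] := valP t.
by apply/andP; split => //=; rewrite (inj_eq perm_inj).
Qed.

Let psif (t : sides) : sides :=
  exist _ (next_copy (val t)) (psi_proof t).

Let psif_inj : injective psif.
Proof.
move=> s t /(congr1 val) e; apply: val_inj; move: e.
rewrite /= /next_copy; case: (val s) => -[c j] i; case: (val t) => -[c' j'] i'.
by move=> /= -[<- <- /perm_inj->].
Qed.

(** The gluing equations suffice: a vertex of type [c] is a copy of the letters moved by [c],
    rotated by [c], and balance allows the sides to be matched. A copy may consist of several cycles
    of [c], which only adds vertices; hence the inequality. *)
Lemma realization : exists (D : finType) (p : D -> 'I_L) (si ph : {perm D}),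
  [/\ surface p si ph, #|D| = \sum_c x c * vsize c &
      \sum_c x c * (c != 1%g) <= nvert si ph].
Proof.
have [xv xeq] := xb.
pose p (t : sides) := (val t).2; pose q (t : sides) := ord_pred ((val t).1.1 (val t).2).
pose sw (h : 'I_L * 'I_L) := (h.2, h.1).
have swK : involutive sw by case.
have cnt i j : #|[pred t | (p t, q t) == (i, j)]| = \sum_c x c * arc c i j.
  transitivity #|[pred t : sides | ((val t).2 == i) &&
       (ord_pred ((val t).1.1 (val t).2) == j)]|.
    by apply: eq_card.
  rewrite (count_sides (fun c k => (k == i) && (ord_pred (c k) == j))).
  apply: eq_bigr => c _; congr (_ * _).
  case a: (arc c i j).
    rewrite (eq_card (B := pred1 i)) ?card1 // => k; rewrite !inE.
    by case: (eqVneq k i) => [->|]; rewrite ?andbF //= -/(arc c i j) a.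
  apply: eq_card0 => k; rewrite !inE.
  by case: (eqVneq k i) => [->|]; rewrite ?andbF //= -/(arc c i j) a.
have [si [siK kq]] : exists si : {perm sides}, (forall t, si (si t) = t) /\
    forall t, (p (si t), q (si t)) = sw (p t, q t).
  by apply: matching => // -[i j]; rewrite !cnt xeq.
pose psi := perm psif_inj.
have ppsi t : p (psi t) = ordS (q t) by rewrite permE /q ord_predK.
(* The face permutation is forced, since [si * ph] must be the rotation [psi]. *)
exists sides, p, si, (si * psi)%g; split.
- split=> // d; first by have [_ e] := kq d; rewrite permM ppsi e.
  have [-> _] := kq d; have /andP[h1 h2] := valP d.
  by apply: xv => //; apply: leq_ltn_trans h1.
- rewrite -cardsT -(eq_card (A := [pred t : sides | xpredT (val t).2])); last first.
    by move=> t; rewrite !inE.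
  rewrite (count_sides (fun _ => xpredT)); apply: eq_bigr => c _; congr (_ * _).
  by apply: eq_card => i; rewrite !inE andbT.
rewrite /nvert mulgA; have -> : (si * si)%g = 1%g.
  by apply/permP=> t; rewrite permM siK perm1.
rewrite mul1g.
have ex_i (c : {perm 'I_L}) : exists i : option 'I_L, c != 1%g -> if i is Some i then c i != i else false.
  case: (eqVneq c 1%g) => [_|nc]; first by exists None.
  have := neq1_vsize c; rewrite nc card_gt0 => /set0Pn[i]; rewrite inE => ci.
  by exists (Some i).
have [ic icP] := choice ex_i.
pose C : finType := ({perm 'I_L} * 'I_N)%type.
pose P := [pred a : C | (a.2 < x a.1) && (a.1 != 1%g)].
have -> : \sum_c x c * (c != 1%g) = #|P|.
  have -> : #|P| = \sum_(a : C) if (a.2 < x a.1) && (a.1 != 1%g) then 1 else 0.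
    by rewrite -sum1_card big_mkcond.
  rewrite -(pair_bigA _ (fun (c : {perm 'I_L}) (j : 'I_N) => if (j < x c) && (c != 1%g) then 1 else 0)) /=.
  apply: eq_bigr => c _; case: (c == 1%g) => /=.
    by rewrite muln0 big1 // => j _; rewrite andbF.
  rewrite muln1 -big_mkcond (eq_bigl (fun j : 'I_N => j < x c)); last by move=> j; rewrite andbT.
  by rewrite sum1_card (card_ltn_ord (le_N c)).
pose h (a : C) : option sides := if ic a.1 is Some i then insub (a, i) else None.
have hP a : P a -> exists2 t, h a = Some t & (val t).1 = a.
  move=> /andP[a1 a2]; have := icP a.1 a2; rewrite /h; case: (ic a.1) => // i ci.
  have Pt : ((a, i).1.2 < x (a, i).1.1) && ((a, i).1.1 (a, i).2 != (a, i).2).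
    by rewrite /= a1 ci.
  by exists (Sub (a, i) Pt); rewrite ?insubT.
pose H a := if h a is Some t then porbit psi t else set0.
rewrite -(card_in_image (f := H) (A := P)).
  apply: subset_leq_card; apply/subsetP => _ /imageP[a Pa ->].
  by have [t ht _] := hP a Pa; rewrite /H ht imset_f.
move=> a b Pa Pb; rewrite /H.
have [t -> ta] := hP a Pa; have [s -> sb] := hP b Pb.
move=> /eqP; rewrite eq_porbit_mem -ta -sb; 
apply: (porbit_inv (s := psi) (f := fun r : sides => (val r).1)) => r.
by rewrite permE.
Qed.
End Realization.

End Surfaces.

(** * From surfaces to vectors of vertex types *)

Section Extremal.
Variables (A : eqType) (L : nat) (u : L.-tuple (A * bool)).
Hypothesis u_red : cyclically_reduced u.

Section VertexTypes.
Variables (D : finType) (S : {set D}) (p : D -> 'I_L) (si ph : {perm D}).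
Hypothesis sf : surface_on u S p si ph.
Let psi : {perm D} := (si * ph)%g.

Let siK d : si (si d) = d. Proof. by case: sf. Qed.

Let si_in d : d \in S -> si d \in S.
Proof.
have [out _ _ _] := sf; move=> dS; apply/negPn/negP => h.
by have [e _] := out _ h; rewrite -e siK dS in h.
Qed.

Let psi_in d : d \in S -> psi d \in S.
Proof.
have [out _ _ _] := sf; move=> /si_in; rewrite permM => dS.
by apply/negPn/negP => h; have [_ /perm_inj e] := out _ h; rewrite e dS in h.
Qed.

Let psi_p d : d \in S -> p (psi d) = ordS (p (si d)).
Proof. by case: sf => _ _ h _ dS; rewrite permM h // si_in. Qed.

(** Equality would make a letter of the relator cyclically followed by its inverse. Hence a vertex
    type moves every letter at its vertex, and [vsize] counts all the sides there. *)
Lemma psi_p_neq d : d \in S -> p (psi d) != p d.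
Proof.
move=> dS; apply/eqP => e; case: (@u_red (p (si d))).
rewrite -psi_p // e -[LHS](@inv_letterK A); congr inv_letter.
by case: sf => _ _ _ ->.
Qed.

Let porbit_in d : d \in S -> {subset porbit psi d <= S}.
Proof.
move=> dS e /porbitP[i ->]; elim: i => [|i IH]; first by rewrite expg0 perm1.
by rewrite expgSr permM psi_in.
Qed.

Hypothesis p_inj : forall d e, d \in S -> e \in S -> d \in porbit psi e -> p d = p e -> d = e.

Let orbit_type (O : {set D}) : exists c : {perm 'I_L},
  O \in porbits psi -> O \subset S ->
  (forall d, d \in O -> c (p d) = p (psi d)) /\
  (forall i, (forall d, d \in O -> p d <> i) -> c i = i).
Proof.
have [/andP[/imsetP[d0 _ EO] OS]|nO] := boolP ((O \in porbits psi) && (O \subset S));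
  last first.
  by exists 1%g => h1 h2; move: nO; rewrite h1 h2.
pose f i := if [pick d in O | p d == i] is Some d then p (psi d) else i.
have Oinj d e : d \in O -> e \in O -> p d = p e -> d = e.
  move=> dO eO; apply: p_inj; try exact: (subsetP OS).
  by move: dO eO; rewrite EO -!eq_porbit_mem => /eqP-> /eqP->.
have Opsi d : d \in O -> psi d \in O.
  by rewrite EO -!eq_porbit_mem porbit_step.
have fO d : d \in O -> f (p d) = p (psi d).
  move=> dO; rewrite /f; case: pickP => [e /andP[eO /eqP e1]|/(_ d)].
    by rewrite (Oinj e d).
  by rewrite dO eqxx.
have fN i : (forall d, d \in O -> p d <> i) -> f i = i.
  by move=> h; rewrite /f; case: pickP => // d /andP[/h + /eqP].
have fcase i : (exists2 d, d \in O & p d = i) \/ f i = i.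
  have [h|h] := EM (exists2 d, d \in O & p d = i); [by left|right].
  by apply: fN => d dO e; apply: h; exists d.
have f_inj : injective f.
  move=> i j; have [[d dO <-]|ei] := fcase i; have [[e eO <-]|ej] := fcase j.
  - rewrite !fO //.
    by move=> /(Oinj _ _ (Opsi _ dO) (Opsi _ eO))/perm_inj->.
  - rewrite fO // ej => eij.
    have := fO _ (Opsi _ dO); rewrite eij ej -eij => /esym/eqP.
    by rewrite (negPf (psi_p_neq _)) // (subsetP OS) ?Opsi.
  - rewrite fO // ei => eij.
    have := fO _ (Opsi _ eO); rewrite -eij ei eij => /esym/eqP.
    by rewrite (negPf (psi_p_neq _)) // (subsetP OS) ?Opsi.
  by rewrite ei ej.
exists (perm f_inj) => _ _; split=> [d dO|i h]; rewrite permE ?fO ?fN //.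
Qed.

(** [x] counts the vertices of each type; it is balanced because [si] exchanges the arcs [(i, j)]
    and [(j, i)]. *)
Lemma vertex_vector : exists x : {ffun {perm 'I_L} -> nat},
  [/\ balanced u x, \sum_c x c * vsize c = #|S| &
      nvert si ph + #|S| <= \sum_c x c * (c != 1%g) + #|D|].
Proof.
have [c cP] := choice orbit_type.
pose Os := [set O in porbits psi | O \subset S].
have OsP O : O \in Os -> O \in porbits psi /\ O \subset S.
  by rewrite inE => /andP[].
pose x : {ffun {perm 'I_L} -> nat} := [ffun t => #|[set O in Os | c O == t]|].
have sum_x (g : {perm 'I_L} -> nat) : \sum_t x t * g t = \sum_(O in Os) g (c O).
  rewrite [RHS](partition_big c xpredT) //=; apply: eq_bigr => t _.
  rewrite ffunE -sum_nat_const; apply: eq_big => [O|O]; first by rewrite inE.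
  by rewrite inE => /andP[_ /eqP->].
have sum_O (R : pred D) : \sum_(O in Os) #|[set d in O | R d]| = #|[set d in S | R d]|.
  rewrite -[RHS]sum1_card (partition_big (porbit psi) (mem Os)) /=; last first.
    move=> d; rewrite !inE => /andP[dS _]; rewrite imset_f //.
    by apply/subsetP; exact: porbit_in.
  apply: eq_bigr => O /OsP[/imsetP[d0 _ EO] OS]; rewrite -sum1_card.
  apply: eq_bigl => d; rewrite !inE EO eq_porbit_mem.
  case dO: (d \in porbit psi d0); rewrite ?andbF //= andbT.
  by rewrite (subsetP OS) // EO.
have Oinj O d e : O \in Os -> d \in O -> e \in O -> p d = p e -> d = e.
  move=> /OsP[/imsetP[d0 _ EO] OS] dO eO; apply: p_inj; try exact: (subsetP OS).
  by move: dO eO; rewrite EO -!eq_porbit_mem => /eqP-> /eqP->.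
have cO O d : O \in Os -> d \in O -> c O (p d) = p (psi d).
  by move=> /OsP[h1 h2]; have [h _] := cP O h1 h2; exact: h.
have cN O i : O \in Os -> c O i != i -> exists2 d, d \in O & p d = i.
  move=> /OsP[h1 h2]; have [_ h] := cP O h1 h2 => ci.
  apply: contrapT => h3; move: ci; rewrite h ?eqxx // => d dO e.
  by apply: h3; exists d.
have OS O d : O \in Os -> d \in O -> d \in S.
  by move=> /OsP[_ /subsetP]; apply.
have arcO O i j : O \in Os ->
    arc (c O) i j = #|[set d in O | (p d == i) && (p (si d) == j)]| :> nat.
  move=> OO; case a: (arc (c O) i j).
    move: a => /andP[ci cj]; have [d dO pd] := cN O i OO ci.
    rewrite (_ : [set _ in _ | _] = [set d]) ?cards1 //; apply/setP=> e.
    rewrite !inE; apply/idP/eqP => [/andP[eO /andP[/eqP pe _]]|->].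
      by apply: (Oinj O) => //; rewrite pd pe.
    rewrite dO pd eqxx -(eqP cj) -pd cO // psi_p ?ordSK ?eqxx //; exact: OS OO dO.
  symmetry; apply/eqP; rewrite -leqn0 leqNgt card_gt0; apply/negP.
  case/set0Pn=> d; rewrite !inE.
  move=> /andP[dO /andP[/eqP pd /eqP psd]].
  have dS := OS O d OO dO.
  move: a; rewrite /arc -pd cO // psi_p_neq // psi_p //= psd.
  by rewrite ordSK eqxx.
have vO O : O \in Os -> vsize (c O) = #|O|.
  move=> OO; rewrite /vsize; have -> : [set i | c O i != i] = p @: O.
    apply/setP=> i; rewrite inE; apply/idP/imsetP => [/(cN O i OO)[d dO pd]|[d dO ->]].
      by exists d.
    by rewrite cO // psi_p_neq // (OS O).
  by rewrite card_in_imset // => d e; apply: Oinj.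
have c1 O : O \in Os -> c O != 1%g.
  move=> OO; have [/imsetP[d0 _ EO] _] := OsP _ OO.
  have d0O : d0 \in O by rewrite EO porbit_id.
  apply: contraTneq (psi_p_neq (OS _ _ OO d0O)) => e.
  by rewrite -(cO O) // e perm1 eqxx.
exists x; split.
- split=> [t|i j].
    rewrite ffunE card_gt0 => /set0Pn[O]; rewrite inE => /andP[OO /eqP<-] i ci.
    have [d dO pd] := cN O i OO ci; have dS := OS O d OO dO.
    rewrite -pd cO // psi_p // ordSK; by case: sf => _ _ _ ->.
  rewrite (sum_x (fun t => arc t i j)) (sum_x (fun t => arc t j i)).
  rewrite (eq_bigr _ (fun O OO => arcO O i j OO)).
  rewrite (eq_bigr _ (fun O OO => arcO O j i OO)) !sum_O.
  rewrite -(card_imset _ (@perm_inj _ si)); apply: eq_card => d.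
  apply/imsetP/idP => [[e]|]; rewrite !inE.
    by move=> /andP[eS /andP[pe pse]] ->; rewrite siK si_in // pe pse.
  move=> /andP[dS /andP[pd psd]]; exists (si d); rewrite ?siK //.
  by rewrite inE siK si_in // pd psd.
- rewrite sum_x (eq_bigr _ vO) -[RHS]cardsE.
  have := sum_O xpredT.
  rewrite (eq_bigr (fun O : {set D} => #|O|)) => [->|O _].
    by apply: eq_card => d; rewrite !inE andbT.
  by apply: eq_card => d; rewrite !inE andbT.
rewrite (sum_x (fun t => (t != 1%g) : nat)) (eq_bigr (fun=> 1)); last first.
  by move=> O /c1->.
rewrite sum1_card /nvert -/psi -(cardsC S).
rewrite -(cardsID [set O : {set D} | O \subset S] (porbits psi)).
have -> : porbits psi :&: [set O : {set D} | O \subset S] = Os.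
  by apply/setP=> O; rewrite !inE.
suff : #|porbits psi :\: [set O : {set D} | O \subset S]| <= #|~: S|.
  by rewrite cardsE; lia.
apply: leq_trans (leq_imset_card (porbit psi) _).
apply: subset_leq_card; apply/subsetP=> O; rewrite !inE => /andP[/subsetPn[d dO dS]].
move=> /imsetP[d0 _ EO]; apply/imsetP; exists d; rewrite ?inE //.
by rewrite EO; apply/eqP; rewrite eq_porbit_mem porbit_sym -EO.
Qed.
End VertexTypes.

(** Injectivity of [p] at each vertex is reached by splitting: exchanging two sides with the same
    letter at a vertex adds a vertex, and there are never more than [#|D|]. *)
Lemma surface_vector (D : finType) (S : {set D}) (p : D -> 'I_L)
    (si ph : {perm D}) : surface_on u S p si ph ->
  exists x : {ffun {perm 'I_L} -> nat},
  [/\ balanced u x, \sum_c x c * vsize c = #|S| &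
      nvert si ph + #|S| <= \sum_c x c * (c != 1%g) + #|D|].
Proof.
move: {2}(#|D| - nvert si ph).+1 (ltnSn (#|D| - nvert si ph)) => n.
elim: n ph => [//|n IH] ph le_n sf.
have [[e [e' [eS e'S eO pe nee]]]|h] := EM (exists e e',
    [/\ e \in S, e' \in S, e \in porbit (si * ph)%g e', p e = p e' & e != e']).
  have := porbits_splitr nee eO; rewrite -mulgA => E.
  have le_D : #|porbits (si * (ph * tperm e e'))%g| <= #|D|.
    exact: leq_imset_card.
  have [out siK pS lS] := sf.
  have [||x [xb xs xn]] := IH (ph * tperm e e')%g.
  - by move: le_n le_D; rewrite /nvert E; lia.
  - split=> // d dS.
      have [-> ph_d] := out d dS; split=> //; rewrite permM ph_d tpermD //.
        by apply: contraNneq dS => <-.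
      by apply: contraNneq dS => <-.
    by rewrite permM -pS //; case: tpermP => // ->; rewrite pe.
  by exists x; split=> //; move: xn; rewrite /nvert E; lia.
apply: (vertex_vector sf) => d e dS eS dO pde; apply/eqP/negPn/negP => nde.
by apply: h; exists d, e.
Qed.

End Extremal.

(** * Extremal surfaces *)

(** Words trivial in the free group, built by insertions so that an induction removes one cancelling
    pair at a time. *)
Inductive null_word (A : Type) : seq (A * bool) -> Prop :=
| null_nil : null_word [::]
| null_insert w1 x w2 : null_word (w1 ++ w2) ->
    null_word (w1 ++ x :: inv_letter x :: w2).

Section VertexPaths.
Variable D : finType.
Implicit Types (si psi : {perm D}) (a b c d : D) (s : seq D).

(* Paths in the 1-skeleton of a surface: [s] lists the sides traversed, from
   the vertex that the side [a] leaves to the vertex that [b] leaves. *)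
Fixpoint vpath si psi a s b : bool :=
  if s is d :: s' then (a \in porbit psi d) && vpath si psi (si d) s' b
  else a \in porbit psi b.

Lemma vpath_start si psi a a' s b : a' \in porbit psi a ->
  vpath si psi a s b -> vpath si psi a' s b.
Proof.
by case: s => [|d s] /=; rewrite -!eq_porbit_mem => /eqP->.
Qed.

Lemma vpath_cat si psi a s d s' b :
  vpath si psi a s d -> vpath si psi d s' b -> vpath si psi a (s ++ s') b.
Proof.
elim: s a => [|x s IH] a /=; first exact: vpath_start.
by move=> /andP[-> /IH]; apply.
Qed.

Lemma vpath_split si psi a s d s' b : vpath si psi a (s ++ d :: s') b ->
  vpath si psi a s d /\ vpath si psi (si d) s' b.
Proof.
elim: s a => [|x s IH] a /=; first by move=> /andP.
by move=> /andP[-> /IH[]].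
Qed.

Lemma vpath_mono (P : pred D) si psi si' psi' a s b :
  P a -> P b -> all P s -> all (P \o si) s -> {in s, si =1 si'} ->
  (forall x y, P x -> P y -> x \in porbit psi y -> x \in porbit psi' y) ->
  vpath si psi a s b -> vpath si' psi' a s b.
Proof.
move=> + Pb + + + PP; elim: s a => [|d s IH] a /= Pa.
  by move=> _ _ _; exact: PP.
move=> /andP[Pd Ps] /andP[Psd Pss] E /andP[ad ds].
rewrite PP // -E ?mem_head //=; apply: IH => // x xs.
by apply: E; rewrite inE xs orbT.
Qed.

Lemma vpath_vertex si psi a s b x : vpath si psi a s b -> x \in rcons s b ->
  porbit psi x \in map (porbit psi) (a :: map si s).
Proof.
elim: s a => [|d s IH] a /=.
  by rewrite -eq_porbit_mem !inE => /eqP-> /eqP->.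
rewrite -eq_porbit_mem => /andP[/eqP ad ds]; rewrite inE => /orP[/eqP->|xs].
  by rewrite ad mem_head.
by rewrite inE IH ?orbT.
Qed.
End VertexPaths.

Lemma uniq_map_coarser (T : eqType) (U V : eqType) (f : T -> U) (g : T -> V) s :
  (forall x y, f x = f y -> g x = g y) -> uniq (map g s) -> uniq (map f s).
Proof.
move=> fg; elim: s => //= x s IH /andP[xs /IH->]; rewrite andbT.
by apply: contra xs => /mapP[y ys /fg->]; exact: map_f.
Qed.

Section Tight.
Variables (A : eqType) (L : nat) (u : L.-tuple (A * bool)).
Hypothesis u_red : cyclically_reduced u.

(** Maximality of the ratio of vertices to sides, cross-multiplied; competitors of every degree are
    allowed. *)
Definition tight (D : finType) (p : D -> 'I_L) (si ph : {perm D}) : Prop :=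
  surface u p si ph /\ forall (D' : finType) (p' : D' -> 'I_L) si' ph',
    surface u p' si' ph' -> nvert si' ph' * #|D| <= nvert si ph * #|D'|.

Lemma surface_onT (D : finType) (p : D -> 'I_L) (si ph : {perm D}) :
  surface u p si ph -> surface_on u setT p si ph.
Proof. by case=> h1 h2 h3; split=> // d; rewrite ?inE. Qed.

Lemma tight_exists (D : finType) (S : {set D}) (p : D -> 'I_L)
    (si ph : {perm D}) : surface_on u S p si ph -> 0 < #|S| ->
  exists (D' : finType) (p' : D' -> 'I_L) (si' ph' : {perm D'}),
    [/\ tight p' si' ph', 0 < #|D'| &
      forall v, v + #|D| <= nvert si ph + #|S| ->
        v * #|D'| <= nvert si' ph' * #|S|].
Proof.
move=> sf S_gt0; have [x [xb xs xv]] := surface_vector u_red sf.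
have [|y [yb y_gt0 ymax]] := @max_ratio _ (balanced u)
    (fun c => c != 1%g) (@vsize L) (@balanced_sub _ _ u) (@neq1_vsize L).
  by exists x; rewrite xs.
have [D' [p' [si' [ph' [sf' D's nv']]]]] := realization yb.
exists D', p', si', ph'; split; last first.
- move=> v le_v; have vx : v <= \sum_c x c * (c != 1%g) by lia.
  apply: leq_trans (leq_mul vx (leqnn _)) _.
  have := ymax x xb; rewrite xs -D's => /(_ S_gt0) /leq_trans; apply.
  by rewrite leq_mul2r nv' orbT.
- by rewrite D's.
split=> // E q t f tf; have [z [zb zs zv]] := surface_vector u_red (surface_onT tf).
rewrite cardsT in zs zv.
have [E0|E_gt0] := posnP #|E|.
  have : nvert t f <= #|E| by apply: leq_imset_card.
  by rewrite E0; case: (nvert t f).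
have tz : nvert t f <= \sum_c z c * (c != 1%g) by lia.
apply: leq_trans (leq_mul tz (leqnn _)) _.
have := ymax z zb; rewrite zs -D's => /(_ E_gt0) /leq_trans; apply.
by rewrite leq_mul2r nv' orbT.
Qed.

Section Surgery.
Variables (D : finType) (p : D -> 'I_L).
Implicit Types (si ph : {perm D}).

Definition lab (d : D) := tnth u (p d).

(* Two sides leaving the same vertex and reading the same letter of the relator
   can be exchanged in [ph], which splits the vertex. *)
Lemma tight_split si ph a b :
  tight p si ph -> a \in porbit (si * ph)%g b -> p a = p b -> a = b.
Proof.
move=> [[siK pS lS] mx] ab pab; apply/eqP/negPn/negP => nab.
have D_gt0 : 0 < #|D| by apply/card_gt0P; exists a.
have /mx : surface u p si (ph * tperm a b)%g.
  by split=> // d; rewrite permM -pS; case: tpermP => // ->.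
by rewrite /nvert mulgA porbits_splitr // leq_pmul2r // ltnn.
Qed.

(* Folding two edges with the same label at the vertex [v] of the path is
   realized on the surface by exchanging their other sides: [v] splits in two and
   the two other ends merge, so the number of vertices is unchanged and the path
   loses two edges. At the end of the process the ends of the path coincide. *)
Lemma tight_null_embedded w : null_word w -> forall si ph a b s,
  tight p si ph -> map lab s = w -> vpath si (si * ph)%g a s b ->
  uniq (map (porbit (si * ph)%g) (a :: map si s)) -> p a = p b -> a = b.
Proof.
elim=> {w} [|w1 l w2 _ IH] si ph a b s tg sw.
  by case: s sw => //= _ ab _; apply: tight_split tg ab.
have [s1 [d [e' [s2 [Es sw1 sw2 ld le']]]]] : exists s1 d e' s2,
    [/\ s = s1 ++ d :: e' :: s2, map lab s1 = w1, map lab s2 = w2, lab d = l &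
        lab e' = inv_letter l].
  exists (take (size w1) s); move: (sw); rewrite -{1}(cat_take_drop (size w1) s).
  have sz : size (take (size w1) s) = size w1.
    by rewrite size_take -(size_map lab s) sw size_cat /=; case: ltnP => //; lia.
  rewrite map_cat => /eqP; rewrite eqseq_cat ?size_map // => /andP[/eqP e1 /eqP].
  case E: (drop (size w1) s) => [|d [|e' s2]] //= [e2 e3 e4].
  by exists d, e', s2; split=> //; rewrite -E cat_take_drop.
subst s; move=> /[dup] pth /vpath_split[pth1 /= /andP[ee' pth2]] us pab.
have [[siK pS lS] mx] := tg.
set psi := (si * ph)%g in pth us pth1 ee' pth2.
set e := si d in ee'.
pose rest := a :: map si s1 ++ map si s2.
have {us} : uniq [:: porbit psi e, porbit psi (si e') & map (porbit psi) rest].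
  rewrite -(perm_uniq (s1 := map (porbit psi) (a :: map si (s1 ++ d :: e' :: s2)))) //.
  rewrite -[X in perm_eq _ X]/(map (porbit psi) ([:: e; si e'] ++ rest)).
  apply: perm_map; rewrite map_cat -cat_cons.
  rewrite -[X in _ ++ X]/([:: e; si e'] ++ map si s2) perm_catCA.
  by rewrite /rest -cat_cons perm_refl.
rewrite cons_uniq [uniq (_ :: _)]cons_uniq inE negb_or -andbA.
move=> /and4P[ese' e_rest se'_rest us].
have restP x : x \in rest ->
    porbit psi x != porbit psi e /\ porbit psi x != porbit psi (si e').
  move=> xr; split; first by apply: contra e_rest => /eqP<-; apply: map_f.
  by apply: contra se'_rest => /eqP<-; apply: map_f.
have Ee' : porbit psi e = porbit psi e' by apply/eqP; rewrite eq_porbit_mem.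
have d_start : porbit psi d \in map (porbit psi) rest.
  have := vpath_vertex pth1 (x := d); rewrite mem_rcons mem_head => /(_ isT).
  by rewrite /rest -cat_cons map_cat mem_cat => ->.
have startP x : porbit psi x \in map (porbit psi) rest ->
    porbit psi x != porbit psi e /\ porbit psi x != porbit psi (si e').
  by case/mapP=> y /restP yr ->.
have [ned nse'd] := startP d d_start.
have nee' : e != e'.
  by apply: contraNneq nse'd => <-; rewrite /e siK.
have lee' : lab e = lab e' by rewrite le' -ld /lab lS.
pose t := tperm e e'.
have labt x : lab (t x) = lab x by rewrite /t; case: tpermP => // ->.
pose si' := (si ^ t)%g.
have siV : (si^-1)%g = si.
  by apply/permP=> x; apply: (@perm_inj _ si); rewrite permKV siK.
have si'E x : si' x = t (si (t x)) by rewrite /si' conjgE tpermV !permM.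
(* The transposition of [d] and [si e'] merges the two far ends, distinct because the path is
   embedded; then [t] splits the middle vertex. *)
have psi'E : (si' * ph = t * (tperm d (si e') * psi))%g.
  rewrite /si' conjgE tpermV -!mulgA; congr (_ * _)%g; rewrite !mulgA.
  by rewrite mul_tperm_swap siV /e siK -mulgA.
pose psi1 := (tperm d (si e') * psi)%g.
have ndse' : d \notin porbit psi (si e') by rewrite -eq_porbit_mem.
have psi1_e x : porbit psi x = porbit psi e -> porbit psi1 x = porbit psi x.
  move=> xe; apply: porbit_tperm_id; rewrite -eq_porbit_mem xe //.
  by rewrite eq_sym.
have nv : nvert si' ph = nvert si ph.
  rewrite /nvert psi'E -(porbits_merge ndse') -/psi1 /t porbits_split //.
  by rewrite -eq_porbit_mem !psi1_e ?Ee'.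
have tg' : tight p si' ph.
  split; last by move=> D' p' t' f' /mx; rewrite nv.
  split=> // x; first by rewrite !si'E tpermK siK tpermK.
  by rewrite si'E -/(lab _) labt -/(lab x) -(labt x) /lab lS.
have coarser x y : porbit psi x != porbit psi e -> porbit psi y != porbit psi e ->
    x \in porbit psi y -> x \in porbit (si' * ph)%g y.
  move=> nx ny /(merge_coarser ndse') xy; rewrite psi'E porbit_tperm_id //.
    by rewrite porbit_sym psi1_e // porbit_sym -eq_porbit_mem eq_sym.
  by rewrite porbit_sym psi1_e // -Ee' porbit_sym -eq_porbit_mem eq_sym.
have joined : d \in porbit (si' * ph)%g (si e').
  rewrite psi'E porbit_tperm_id; first exact: merge_joins.
    by rewrite porbit_sym psi1_e // -eq_porbit_mem eq_sym.
  by rewrite porbit_sym psi1_e // -Ee' -eq_porbit_mem eq_sym.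
have s_start x : x \in s1 ++ s2 -> porbit psi x \in map (porbit psi) rest \/
    porbit psi x = porbit psi (si e').
  rewrite mem_cat => /orP[xs|xs].
    left; have := vpath_vertex pth1 (x := x); rewrite mem_rcons inE xs orbT.
    by move=> /(_ isT); rewrite /rest -cat_cons map_cat mem_cat => ->.
  have := vpath_vertex pth2 (x := x); rewrite mem_rcons inE xs orbT.
  move=> /(_ isT); rewrite map_cons inE => /orP[/eqP->|h]; [by right | left].
  by rewrite /rest -cat_cons map_cat mem_cat h orbT.
pose P x := porbit psi x != porbit psi e.
have Pse' : P (si e') by rewrite /P eq_sym.
have Ps x : x \in s1 ++ s2 -> P x.
  by case/s_start => [/startP[]|] //; rewrite /P => ->.
have si_rest x : x \in s1 ++ s2 -> si x \in rest.
  by move=> xs; rewrite /rest -map_cat inE map_f ?orbT.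
have si'_eq x : x \in s1 ++ s2 -> si' x = si x.
  move=> xs; have Px := Ps x xs; have [Psx nsx] := restP _ (si_rest x xs).
  have -> : si' x = t (si x).
    rewrite si'E; congr (t (si _)); apply: tpermD.
      by apply: contraNneq Px => <-.
    by apply: contraNneq Px => <-; rewrite Ee'.
  apply: tpermD; first by apply: contraNneq Psx => <-.
  by apply: contraNneq Psx => <-; rewrite Ee'.
apply: (IH si' ph a b (s1 ++ s2)) => //; first by rewrite map_cat sw1 sw2.
- have in1 x : x \in s1 -> x \in s1 ++ s2 by rewrite mem_cat => ->.
  have in2 x : x \in s2 -> x \in s1 ++ s2 by rewrite mem_cat orbC => ->.
  have Pb : P b.
    have := vpath_vertex pth2 (x := b); rewrite mem_rcons mem_head => /(_ isT).
    rewrite map_cons inE /P => /orP[/eqP->|h]; first by rewrite eq_sym.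
    by have [] := startP b; rewrite // /rest -cat_cons map_cat mem_cat h orbT.
  have V1 : vpath si' (si' * ph)%g a s1 d.
    apply: (@vpath_mono _ P si psi) pth1 => //.
    + by have [] := restP a (mem_head _ _).
    + by apply/allP => x /in1/Ps.
    + by apply/allP => x /in1/si_rest/restP[].
    + by move=> x /in1/si'_eq.
  have V2 : vpath si' (si' * ph)%g (si e') s2 b.
    apply: (@vpath_mono _ P si psi) pth2 => //.
    + by apply/allP => x /in2/Ps.
    + by apply/allP => x /in2/si_rest/restP[].
    + by move=> x /in2/si'_eq.
  by apply: vpath_cat V1 _; apply: vpath_start V2.
have -> : a :: map si' (s1 ++ s2) = rest.
  rewrite /rest -map_cat; congr (_ :: _); exact/eq_in_map.
(* [g] identifies the vertex of [si e'] with that of [d]. It is constant on the new orbits and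
   leaves the vertices of [rest] as they were, so these remain distinct. *)
pose g x := if porbit psi x == porbit psi e then porbit psi e
  else if porbit psi x == porbit psi (si e') then porbit psi d else porbit psi x.
apply: (@uniq_map_coarser _ _ _ _ g).
  have gpsi x : g (psi x) = g x by rewrite /g porbit_step.
  have gt x : g (t x) = g x.
    by rewrite /t; case: tpermP => // ->; rewrite /g Ee' eqxx.
  have gt2 x : g (tperm d (si e') x) = g x.
    by case: tpermP => // ->; rewrite /g eqxx (negPf ned) (negPf nse'd) eq_sym (negPf ese').
  move=> x y /eqP; rewrite eq_porbit_mem; apply: porbit_inv => z.
  by rewrite psi'E permM permM gpsi gt2 gt.
have -> : map g rest = map (porbit psi) rest; last exact: us.
by apply/eq_in_map => x /restP[h1 h2]; rewrite /g (negPf h1) (negPf h2).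
Qed.
End Surgery.
End Tight.

(** * Finite covers of extremal surfaces *)

Section Covers.
Variables (A : eqType) (L : nat) (u : L.-tuple (A * bool)).
Variables (D : finType) (p : D -> 'I_L) (si ph : {perm D}).
Variables (m : nat) (sheet : D -> {perm 'I_m}).
Hypothesis sheetV : forall d, sheet (si d) = (sheet d)^-1%g.
Hypothesis siK : forall d, si (si d) = d.

Let E : finType := (D * 'I_m)%type.

Let si_fun (x : E) : E := (si x.1, sheet x.1 x.2).
Let psi_fun (x : E) : E := ((si * ph)%g x.1, x.2).

Let si_funK : involutive si_fun.
Proof. by move=> [d k]; rewrite /si_fun /= siK sheetV permK. Qed.

Let psi_inj : injective psi_fun.
Proof. by move=> [d k] [d' k'] [/perm_inj-> ->]. Qed.

Definition cover_si : {perm E} := perm (inv_inj si_funK).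
Definition cover_psi : {perm E} := perm psi_inj.
Definition cover_ph : {perm E} := (cover_si * cover_psi)%g.
Definition cover_p (x : E) : 'I_L := p x.1.

Lemma cover_siE x : cover_si x = (si x.1, sheet x.1 x.2).
Proof. by rewrite permE. Qed.

Lemma cover_psiE : (cover_si * cover_ph)%g = cover_psi.
Proof.
rewrite /cover_ph mulgA (_ : (cover_si * cover_si)%g = 1%g) ?mul1g //.
by apply/permP=> x; rewrite permM !permE si_funK.
Qed.

Lemma porbit_cover x y :
  (x \in porbit cover_psi y) = (x.1 \in porbit (si * ph)%g y.1) && (x.2 == y.2).
Proof.
have it i : (cover_psi ^+ i)%g y = (((si * ph)%g ^+ i)%g y.1, y.2).
  elim: i => [|i IH]; first by rewrite !expg0 !perm1; case: y.
  by rewrite expgSr permM IH permE /psi_fun expgSr [in RHS]permM.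
apply/porbitP/andP => [[i ->]|[/porbitP[i e1] /eqP e2]].
  by rewrite it /= mem_porbit.
by exists i; rewrite it -e1 -e2; case: x {e1 e2}.
Qed.

Lemma cover_nvert : nvert si ph * m <= nvert cover_si cover_ph.
Proof.
rewrite /nvert cover_psiE -[X in _ * X]card_ord -cardsT -cardsX.
pose h (a : {set D} * 'I_m) : {set E} := [set x | (x.1 \in a.1) && (x.2 == a.2)].
rewrite -(card_in_imset (f := h)).
  apply: subset_leq_card; apply/subsetP=> _ /imsetP[[O k] /setXP[/imsetP[d _ ->] _] ->].
  apply/imsetP; exists (d, k) => //; apply/setP=> x.
  by rewrite porbit_cover inE.
move=> [O k] [O' k'] /setXP[/imsetP[d _ EO] _] _ /setP /= hE.
have := hE (d, k); rewrite !inE /= {1}EO porbit_id eqxx /= => /esym/andP[_ /eqP kk'].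
congr (_, _) => //; apply/setP=> x; have := hE (x, k).
by rewrite !inE /= kk' !eqxx !andbT.
Qed.

(** The rotation lifts without changing sheet, so vertices and sides are both multiplied by [m].
    Faces may unwrap, which is harmless since a face only has to cover the relator. *)
Lemma tight_cover : 0 < m -> tight u p si ph -> tight u cover_p cover_si cover_ph.
Proof.
move=> m_gt0 [[_ pS lS] mx]; split.
  split=> x; first by rewrite !permE si_funK.
    by rewrite /cover_p permM !permE /= permM siK pS.
  by rewrite /cover_p permE lS.
move=> D' p' si' ph' sf'; rewrite card_prod card_ord mulnA.
apply: leq_trans (leq_mul (mx _ _ _ _ sf') (leqnn m)) _.
by rewrite mulnAC leq_mul2r cover_nvert orbT.
Qed.

End Covers.

(** * Reduced paths with trivial image *)

Section ReducedPaths.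
Variables (A : eqType) (L : nat) (u : L.-tuple (A * bool)).
Variables (D : finType) (p : D -> 'I_L) (si ph : {perm D}).
Hypothesis tg : tight u p si ph.

Let siK d : si (si d) = d. Proof. by case: tg => -[]. Qed.

Let lab_si d : lab u p (si d) = inv_letter (lab u p d).
Proof. by case: tg => -[_ _ h] _; apply: h. Qed.

(* As in Marshall Hall's theorem, a reduced path [s] is the projection of an
   embedded path in a finite cover whose sheets are its vertices. *)
Lemma sheets_exist (s : seq D) : sorted (fun x y => y != si x) s ->
  exists sheet : D -> {perm 'I_(size s).+1},
    (forall d, sheet (si d) = (sheet d)^-1%g) /\
    forall i d0, i < size s -> sheet (nth d0 s i) (inord i) = inord i.+1.
Proof.
move=> s_red; set m := size s.
case: (posnP m) => [m0|m_gt0].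
  exists (fun=> 1%g); split; first by move=> d; rewrite invg1.
  by move=> i d0; rewrite m0.
have [d0 _] : exists d0 : D, True by case: s s_red @m m_gt0 => // d s; exists d.
have red i : i.+1 < m -> nth d0 s i.+1 != si (nth d0 s i).
  by move=> im; apply: (sortedP d0 s_red).
pose fwd d (i : 'I_m.+1) := (i < m) && (nth d0 s i == d).
pose bwd d (i : 'I_m.+1) := (0 < i) && (nth d0 s i.-1 == si d).
(* Crossing [d] moves one sheet forward at an occurrence of [d] in the path and one sheet backward
   at an occurrence of [si d]. *)
pose f d (i : 'I_m.+1) : 'I_m.+1 := if fwd d i then inord i.+1 else inord i.-1.
have fb d (i : 'I_m.+1) : fwd d i -> bwd d i -> False.
  move=> /andP[im /eqP e1] /andP[i0 /eqP e2].
  have := @red i.-1; rewrite (prednK i0) => /(_ im).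
  by rewrite e1 e2 siK eqxx.
have f_inj d : {in [set i | fwd d i || bwd d i] &, injective (f d)}.
  (* A forward and a backward step reach the same sheet only if two consecutive sides of the path
     are opposite, against reducedness. *)
  have aux (i j : 'I_m.+1) : fwd d i -> bwd d j -> inord i.+1 = inord j.-1 :> 'I_m.+1 -> False.
    move=> /andP[im /eqP e1] /andP[j0 /eqP e2] /(congr1 (@nat_of_ord _)).
    rewrite !inordK ?ltnS //=; last by have := ltn_ord j; lia.
    move=> e; have im1 : i.+1 < m by have := ltn_ord j; lia.
    by have := red _ im1; rewrite e1 e e2 eqxx.
  move=> i j; rewrite !inE /f => hi hj.
  case: ifP hi => /= fi hi; case: ifP hj => /= fj hj e.
  - apply: val_inj; move: e => /(congr1 (@nat_of_ord _)); case/andP: fi => fi _; case/andP: fj => fj _.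
    by rewrite !inordK //= => -[].
  - by case: (aux i j).
  - by case: (aux j i).
  apply: val_inj; move: e => /(congr1 (@nat_of_ord _)); case/andP: hi => hi _; case/andP: hj => hj _.
  rewrite !inordK //=; have := ltn_ord j; have := ltn_ord i; lia.
have [c cP] := choice (fun d => perm_extend (@f_inj d)).
(* The sign of the letter selects one side of each edge; the opposite side gets the inverse
   permutation. *)
exists (fun d => if (lab u p d).2 then c d else (c (si d))^-1%g); split.
  by move=> d; rewrite lab_si /= siK; case: (lab u p d).2; rewrite //= invgK.
move=> i d1 im; rewrite (set_nth_default d0) //; set d := nth d0 s i.
have vi : (inord i : 'I_m.+1) = i :> nat by rewrite inordK // ltnS ltnW.
have vi1 : (inord i.+1 : 'I_m.+1) = i.+1 :> nat by rewrite inordK.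
case: ifP => _.
  have fd : fwd d (inord i) by rewrite /fwd vi im /= eqxx.
  by rewrite cP ?inE ?fd // /f fd vi.
have bd : bwd (si d) (inord i.+1) by rewrite /bwd vi1 /= siK eqxx.
apply: (@perm_inj _ (c (si d))); rewrite permKV cP ?inE ?bd ?orbT // /f.
case: ifP => [/fb/(_ bd)//|_]; by rewrite vi1.
Qed.

(** The lift of [s] from sheet 0 visits the sheets 0, ..., [m] in order, hence is embedded. As the
    cover is tight, the ends of the lift agree, which forces [m = 0]. *)
Lemma tight_reduced_path s a b : sorted (fun x y => y != si x) s ->
  vpath si (si * ph)%g a s b -> null_word (map (lab u p) s) -> p a = p b ->
  s = [::] /\ a = b.
Proof.
move=> s_red pth nul pab.
have [sheet [sheetV sheetS]] := sheets_exist s_red.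
set m := size s in sheet sheetV sheetS.
pose lift i (t : seq D) : seq (D * 'I_m.+1) :=
  [seq (nth a s j, inord j) | j <- iota i (size t)].
have tc := tight_cover sheetV siK (ltn0Sn m) tg.
pose csi := cover_si sheetV siK; pose cpsi := cover_psi si ph m.+1.
have lift_path t x i : t = drop i s -> i + size t = m ->
    vpath si (si * ph)%g x t b ->
    vpath csi cpsi (x, inord i) (lift i t) (b, inord m).
  elim: t x i => [|d t IH] x i /= Et im.
    by rewrite addn0 in im; rewrite im porbit_cover /= eqxx andbT.
  have i_lt : i < m by lia.
  have Ed : nth a s i = d.
    by have := nth_drop i a s 0; rewrite -Et addn0 => <-.
  move=> /andP[xd dt]; rewrite Ed porbit_cover xd eqxx /=.
  rewrite /csi cover_siE /= -{2}Ed sheetS //; apply: IH dt; last by rewrite addSnnS.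
  by rewrite -add1n -drop_drop -Et /= drop0.
have cpth : vpath csi cpsi (a, inord 0) (lift 0 s) (b, inord m).
  by apply: lift_path; rewrite ?drop0.
have s_lift : map fst (lift 0 s) = s.
  rewrite -map_comp -[RHS](mkseq_nth a) /mkseq; exact: eq_map.
have end2 : map snd ((a, inord 0) :: map csi (lift 0 s)) =
    [seq inord j | j <- iota 0 m.+1] :> seq 'I_m.+1.
  rewrite /= -map_comp; congr (_ :: _); rewrite -[1]addn0 iotaDl -!map_comp.
  apply/eq_in_map => j; rewrite mem_iota add0n /= => jm.
  by rewrite /csi cover_siE /= sheetS.
have u2 : uniq (map snd ((a, inord 0) :: map csi (lift 0 s))).
  rewrite end2 map_inj_in_uniq ?iota_uniq // => i j.
  by rewrite !mem_iota !add0n => im jm /(congr1 (@nat_of_ord _)); rewrite !inordK.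
have e : (a, inord 0) = (b, inord m) :> D * 'I_m.+1.
  have psiE : cpsi = (csi * cover_ph ph sheetV siK)%g by rewrite cover_psiE.
  rewrite psiE in cpth.
  apply: (tight_null_embedded (s := lift 0 s) nul tc) => //.
    by rewrite -[in RHS]s_lift -map_comp.
  apply: uniq_map_coarser u2 => x y /eqP.
  by rewrite -psiE eq_porbit_mem porbit_cover => /andP[_ /eqP].
have m0 : m = 0.
  by have [_ /(congr1 (@nat_of_ord _))] := e; rewrite !inordK.
by split; [exact: size0nil | case: e].
Qed.

End ReducedPaths.

(** * Surfaces bounded by products of commutators *)

Section CycleOfSeq.
Local Open Scope group_scope.
Variable T : finType.
Implicit Types (s t r : seq T) (x y z a b c : T) (si : {perm T}).

(** The cyclic permutation along [s], written with transpositions so that an edit of the boundary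
    word has a controlled effect on the number of orbits. *)
Fixpoint cyc s : {perm T} :=
  if s is x :: s' then
    if s' is y :: _ then cyc s' * tperm x y else 1
  else 1.

Lemma cyc_out s x : x \notin s -> cyc s x = x.
Proof.
elim: s => [|y [|z s] IH] /=; rewrite ?perm1 // => xs.
rewrite permM IH; last by move: xs; rewrite inE negb_or => /andP[].
by move: xs; rewrite !inE !negb_or => /and3P[xy xz _]; rewrite tpermD // eq_sym.
Qed.

Lemma cyc_tperm s x y : x \notin s -> y \notin s ->
  commute (cyc s) (tperm x y).
Proof.
by move=> xs ys; rewrite /commute [RHS]conjgC tpermJ !cyc_out.
Qed.

Lemma cyc_commute s t : ~~ has (mem s) t -> commute (cyc s) (cyc t).
Proof.
elim: t => [|y [|z t] IH] /= h; try exact: commute1.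
move: h; rewrite !negb_or => /and3P[ys zs ts].
apply: commuteM; first by apply: IH; rewrite /= negb_or zs.
exact: cyc_tperm.
Qed.

Lemma cyc_cat a s b t : uniq (a :: s ++ b :: t) ->
  cyc (a :: s ++ b :: t) = cyc (a :: s) * cyc (b :: t) * tperm a b.
Proof.
elim: s a => [|y s IH] a; first by rewrite /= mul1g.
move=> /andP[a_out us]; rewrite cat_cons.
have -> : cyc (a :: y :: (s ++ b :: t)) = cyc (y :: s ++ b :: t) * tperm a y by [].
have -> : cyc (a :: y :: s) = cyc (y :: s) * tperm a y by [].
rewrite IH // -!mulgA; congr (_ * _).
have : commute (cyc (b :: t)) (tperm a y).
  apply: cyc_tperm.
    by apply: contra a_out => h; rewrite /= !(inE, mem_cat) -[(a == b) || _]in_cons h !orbT.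
  by move: us => /andP[+ _]; rewrite mem_cat negb_or => /andP[].
rewrite /commute => E; rewrite [RHS]mulgA -E -mulgA; congr (_ * _).
have ay : a != y by apply: contraNneq a_out => ->; rewrite mem_head.
have ab : a != b by apply: contraNneq a_out => ->; rewrite !(inE, mem_cat) eqxx !orbT.
have yb : y != b.
  by move: us => /andP[+ _]; apply: contraNneq => ->; rewrite mem_cat mem_head orbT.
by rewrite [LHS]conjgC tpermJ tpermR tpermD.
Qed.

Lemma cyc_rot s t : uniq (s ++ t) -> cyc (s ++ t) = cyc (t ++ s).
Proof.
case: s t => [|a s] [|b t] us; rewrite ?cats0 //.
have us' : uniq (b :: t ++ a :: s) by rewrite -cat_cons uniq_catC.
rewrite !cat_cons (cyc_cat us) (cyc_cat us') tpermC (_ : commute (cyc (a :: s)) (cyc (b :: t))) //.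
by apply: cyc_commute; have := us; rewrite (cat_uniq (a :: s)) => /and3P[].
Qed.

Lemma cyc_nth x0 s i : uniq s -> i < size s ->
  cyc s (nth x0 s i) = nth x0 s (i.+1 %% size s).
Proof.
have main x s' : uniq (x :: s') ->
   (forall i, i < size s' -> cyc (x :: s') (nth x0 (x :: s') i) = nth x0 s' i) /\
   cyc (x :: s') (last x s') = x.
  elim: s' x => [|y s' IH] x; first by rewrite /= perm1.
  move=> /andP[xs us]; have [IH1 IH2] := IH y us.
  have -> : cyc (x :: y :: s') = cyc (y :: s') * tperm x y by [].
  split=> [[|j] jm|]; last by rewrite permM [last _ _]/= IH2 tpermR.
    by rewrite permM [nth _ _ _]/= cyc_out // tpermL.
  rewrite permM [nth _ (x :: _) _]/= IH1 // tpermD //.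
    by apply: contraNneq xs => ->; rewrite inE mem_nth ?orbT.
  by move: us => /andP[+ _]; apply: contraNneq => ->; rewrite mem_nth.
case: s => // x s us; have [h1 h2] := main x s us.
rewrite [size _]/= ltnS leq_eqVlt => /orP[/eqP->|im].
  by rewrite modnn nth_last h2.
by rewrite h1 // modn_small.
Qed.

(* Exchanging two consecutive blocks multiplies the cycle by a 3-cycle. *)
Lemma cyc_swap si s t r : uniq (s ++ t ++ r) ->
  #|porbits (si * cyc (s ++ t ++ r))| <= #|porbits (si * cyc (t ++ s ++ r))|.+2.
Proof.
case: s t r => [|b s] [|c t] [|e r] us; rewrite ?cats0 ?cat0s;
  try by rewrite leqW ?leqW.
  by rewrite cyc_rot ?leqW ?leqW //; move: us; rewrite ?cats0.
have us2 : uniq ((c :: t) ++ (b :: s) ++ (e :: r)).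
  by rewrite (perm_uniq (s2 := (b :: s) ++ (c :: t) ++ (e :: r))) // perm_catCA.
have u1 : uniq ((c :: t) ++ (e :: r)).
  by move: us; rewrite cat_uniq => /and3P[].
have u2 : uniq ((b :: s) ++ (e :: r)).
  by move: us2; rewrite cat_uniq => /and3P[].
have bc : b != c.
  by move: us => /andP[+ _]; apply: contraNneq => ->; rewrite !(inE, mem_cat) eqxx !orbT.
rewrite !cat_cons in us us2 u1 u2 *.
rewrite (cyc_cat us) (cyc_cat us2) (cyc_cat u1) (cyc_cat u2).
have cm : commute (cyc (b :: s)) (cyc (c :: t)).
  apply: cyc_commute; have := us.
  rewrite -[_ :: _]/((b :: s) ++ (c :: t) ++ e :: r) catA cat_uniq => /and3P[+ _ _].
  by rewrite cat_uniq => /and3P[].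
have be : b != e.
  by move: us => /andP[+ _]; apply: contraNneq => ->; rewrite !(inE, mem_cat) eqxx !orbT.

have ce : c != e.
  by move: us2 => /andP[+ _]; apply: contraNneq => ->; rewrite !(inE, mem_cat) eqxx !orbT.
have ec : e != c by rewrite eq_sym.
have cb : c != b by rewrite eq_sym.
have -> : cyc (c :: t) * (cyc (b :: s) * cyc (e :: r) * tperm b e) * tperm c b
  = cyc (b :: s) * (cyc (c :: t) * cyc (e :: r) * tperm c e) * tperm b c *
    tperm b e * tperm c e.
  rewrite !mulgA -cm -!mulgA; do 3!congr (_ * _).
  have -> : tperm b c * (tperm b e * tperm c e) = tperm b e.
    rewrite mulgA [tperm b c * _]conjgC tpermJ tpermL tpermD //.
    by rewrite [tperm e c]tpermC -mulgA tperm2 mulg1.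
  by rewrite [LHS]conjgCV tpermV tpermJ tpermL tpermD.
rewrite !mulgA.
apply: leq_trans (porbits_tpermr_ge _ b e) _; rewrite ltnS.
exact: porbits_tpermr_ge.
Qed.
End CycleOfSeq.

(** * One-face surfaces built from a boundary word *)

Section Gluing.
Variables (A : eqType) (D : finType).
Implicit Types (l : D -> A * bool) (si : {perm D}) (s r : seq D).
Implicit Types (d e : D) (w : seq (A * bool)) (k : nat).

(* A surface with one face, read along [s]; the sides off [s] are not used.
   The last clause says that [V - E >= - k], where each unused side accounts
   for one of the orbits counted by [nvert]. *)
Definition glued l si s k : Prop :=
  [/\ uniq s, forall d, d \notin s -> si d = d, forall d, si (si d) = d,
      forall d, d \in s -> l (si d) = inv_letter (l d) &
      #|D|.*2 <= (nvert si (cyc s)).*2 + size s + k.*2].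

Lemma nvert11 : nvert (1 : {perm D}) 1 = #|D|.
Proof.
rewrite /nvert mul1g card_imset // => d e /eqP.
rewrite eq_porbit_mem => /porbitP[i ->]; by rewrite expg1n perm1.
Qed.

Lemma nvert_pair si d d' r k : uniq (d :: d' :: r) -> si d = d -> si d' = d' ->
  (forall e, e \notin r -> si e = e) ->
  (#|D|.*2 <= (nvert (tperm d d' * si)%g (cyc (d :: d' :: r))).*2 +
     size (d :: d' :: r) + k.*2)
  = (#|D|.*2 <= (nvert si (cyc r)).*2 + size r + k.*2).
Proof.
move=> ud sid sid' si_out; case: r ud si_out => [|x r] ud si_out.
  have -> : si = 1%g by apply/permP=> e; rewrite perm1 si_out.
  have -> : cyc [:: d; d'] = tperm d d' by rewrite /= mul1g.
  (* For empty [r] both permutations are trivial, all [#|D|] points are orbits, and both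
     inequalities hold. *)
  rewrite mulg1 /nvert tperm2 -[X in porbits X]mulg1 -/(nvert 1 1) !nvert11.
  by rewrite -!addnA !leq_addr.
have cyc_pair : cyc (d :: d' :: x :: r) = (cyc (x :: r) * tperm d' x * tperm d d')%g by [].
have sixr : (si * cyc (x :: r))%g d' = d'.
  by rewrite permM sid' cyc_out //; move: ud => /and3P[].
have nd' : d' \notin porbit (si * cyc (x :: r))%g x.
  rewrite porbit_sym; apply/negP => /porbitP[i].
  rewrite permX_fix // => xd; move: ud => /and3P[_ + _].
  by rewrite xd mem_head.
rewrite /nvert cyc_pair.
have -> : (tperm d d' * si * (cyc (x :: r) * tperm d' x * tperm d d')
    = (si * cyc (x :: r) * tperm d' x) ^ tperm d d')%g.
  by rewrite conjgE tpermV !mulgA.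
rewrite porbits_conj -(porbits_merger nd'); congr (_ <= _).
by rewrite /=; lia.
Qed.

(* The conjugation splits one vertex and then either merges or splits two
   others. *)
Lemma conj_tperm_ge si ph e e' : (forall d, si (si d) = d) ->
  e != e' -> e \in porbit (si * ph)%g e' ->
  si e != e -> si e != e' -> si e' != e' ->
  nvert si ph <= nvert (si ^ tperm e e')%g ph.
Proof.
move=> siK nee' ee' n1 n2 n3.
have siV : (si^-1)%g = si.
  by apply/permP=> x; apply: (@perm_inj _ si); rewrite permKV siK.
have n4 : si e' != e by apply: contra n2 => /eqP<-; rewrite siK.
set t := tperm e e'; set t2 := tperm (si e) (si e').
have -> : nvert (si ^ t)%g ph = #|porbits (t2 * (t * (si * ph)))%g|.
  rewrite /nvert; congr (#|porbits _|).
  have E : (t2 * t = t * t2)%g.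
    have t_id z : z != e -> z != e' -> t z = z.
      by move=> m1 m2; rewrite tpermD // eq_sym.
    by rewrite [LHS]conjgC tpermJ !t_id.
  rewrite [RHS]mulgA E conjgE tpermV -!mulgA; congr (_ * _)%g.
  by rewrite !mulgA mul_tperm_swap siV.
by rewrite /nvert -ltnS -(porbits_split nee' ee') porbits_tperm_ge.
Qed.

Lemma cyc_rot_pair d d' s1 s2 : uniq (s1 ++ d :: d' :: s2) ->
  uniq (d :: d' :: s2 ++ s1) /\ cyc (s1 ++ d :: d' :: s2) = cyc (d :: d' :: s2 ++ s1).
Proof. by move=> us; split; [rewrite -!cat_cons uniq_catC | exact: cyc_rot]. Qed.

(** If [d] is glued to another side, regluing it to [d'] loses no vertex by [conj_tperm_ge]; the
    pair then satisfies [nvert_pair] and can be removed. *)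
Lemma glued_cancel l si s1 d d' s2 k :
  glued l si (s1 ++ d :: d' :: s2) k -> l d' = inv_letter (l d) ->
  exists si', glued l si' (s1 ++ s2) k.
Proof.
move=> G ld'.
wlog sid : si G / si d = d'.
  move=> W; case: (eqVneq (si d) d') => [/W//|ne]; first exact.
  have [us si_out siK si_l le] := G.
  have dS : d \in s1 ++ d :: d' :: s2 by rewrite mem_cat mem_head orbT.
  have d'S : d' \in s1 ++ d :: d' :: s2 by rewrite mem_cat !inE eqxx !orbT.
  pose t := tperm d' (si d).
  have lt x : l (t x) = l x.
    by rewrite /t; case: tpermP => // ->; rewrite ld' si_l.
  have lneq x y : l x = l y -> x \in s1 ++ d :: d' :: s2 -> si x != y.
    move=> lxy xS; apply: contra_eq_neq lxy => <-; rewrite si_l //.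
    by apply/eqP=> h; apply: (@inv_letter_neq A (l x)).
  have sidS : si d \in s1 ++ d :: d' :: s2.
    by apply/negPn/negP => h; have := si_out _ h; rewrite siK => e; rewrite -e dS in h.
  have lsid : l (si d) = l d' by rewrite si_l.
  have tS x : x \notin s1 ++ d :: d' :: s2 -> t x = x.
    by move=> xS; apply: tpermD; apply: contraNneq xS => <-.
  apply: (W (si ^ t)%g).
    split=> //.
    - by move=> x xS; rewrite conjgE tpermV !permM tS // si_out // tS.
    - by move=> x; rewrite conjgE tpermV !permM tpermK siK tpermK.
    - move=> x xS; rewrite conjgE tpermV !permM lt si_l ?lt //.
      by rewrite /t; case: tpermP => // _.
    apply: leq_trans le _; rewrite leq_add2r leq_add2r leq_double.
    apply: conj_tperm_ge => //.
    + by rewrite eq_sym.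
    + have e : (si * cyc (s1 ++ d :: d' :: s2))%g (si d) = d'.
        rewrite permM siK; have [us' ->] := cyc_rot_pair us.
        by have := cyc_nth d us' (i := 0) isT; rewrite modn_small.
      by rewrite -eq_porbit_mem -[X in porbit _ X == _]e porbit_step.
    + exact: lneq.
    + exact: lneq.
    + exact: lneq.
  rewrite conjgE tpermV !permM tpermD ?tpermR //.
    by apply/eqP => e; apply: (@inv_letter_neq A (l d)); rewrite -ld' e.
  exact: lneq.
have [us si_out siK si_l le] := G.
have [us' Ecyc] := cyc_rot_pair us.
pose si' := (tperm d d' * si)%g.
have nS x : (x \in s1 ++ d :: d' :: s2) = [|| x == d, x == d' | x \in s1 ++ s2].
  by rewrite !mem_cat !inE; do 4!case: (_ \in _) || case: (_ == _).
have si'd : si' d = d by rewrite permM tpermL -sid siK.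
have si'd' : si' d' = d' by rewrite permM tpermR.
have si'E x : x != d -> x != d' -> si' x = si x.
  by move=> n1 n2; rewrite permM tpermD // eq_sym.
have [n1 n2] : d \notin s1 ++ s2 /\ d' \notin s1 ++ s2.
  move: us' => /and3P[]; rewrite inE negb_or => /andP[_].
  by rewrite !mem_cat !(orbC (_ \in s2)).
exists si'; split.
- by move: us'; rewrite uniq_catC => /and3P[].
- move=> x xS; case: (eqVneq x d) => [->//|nd]; case: (eqVneq x d') => [->//|nd'].
  by rewrite si'E // si_out // nS (negPf nd) (negPf nd') (negPf xS).
- move=> x; case: (eqVneq x d) => [->|nd]; first by rewrite !si'd.
  case: (eqVneq x d') => [->|nd']; first by rewrite !si'd'.
  rewrite si'E // si'E ?siK //.
    by apply: contra nd' => /eqP e; rewrite -(siK x) e sid.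
  by apply: contra nd => /eqP e; rewrite -(siK x) e -sid siK.
- move=> x xS; rewrite si'E ?si_l ?nS ?xS ?orbT //.
    by apply: contraTneq xS => ->.
  by apply: contraTneq xS => ->.
have us2 : uniq (s2 ++ s1) by move: us' => /and3P[].
move: le; rewrite Ecyc (cyc_rot (s := s1)); last by rewrite uniq_catC.
have -> : si = (tperm d d' * si')%g by rewrite /si' mulgA tperm2 mul1g.
have -> : size (s1 ++ d :: d' :: s2) = size (d :: d' :: s2 ++ s1).
  by rewrite /= !size_cat /=; lia.
rewrite nvert_pair //; first by rewrite !size_cat (addnC (size s2)).
move=> x xS; have xS' : x \notin s1 ++ s2 by rewrite mem_cat orbC -mem_cat.
case: (eqVneq x d) => [->//|nd]; case: (eqVneq x d') => [->//|nd'].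
by rewrite si'E // si_out // nS (negPf nd) (negPf nd') (negPf xS').
Qed.

(* Capping the boundary, which reads [w], with a disc gives a closed surface of
   Euler characteristic at least [1 - k]. *)
Definition bounds w k : Prop :=
  exists l si s, map l s = w /\ glued l si s k.

Lemma map_cat_inv (l : D -> A * bool) s w1 w2 : map l s = w1 ++ w2 ->
  exists s1 s2, [/\ s = s1 ++ s2, map l s1 = w1 & map l s2 = w2].
Proof.
move=> E; exists (take (size w1) s), (drop (size w1) s).
by rewrite cat_take_drop map_take map_drop E take_size_cat // drop_size_cat.
Qed.

Lemma bounds_nil (x0 : A * bool) k : bounds [::] k.
Proof.
exists (fun=> x0), 1%g, [::]; split=> //; split=> //; try by move=> d; rewrite ?perm1.
by rewrite nvert11 -addnA leq_addr.
Qed.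

Lemma bounds_cancel w1 x w2 k :
  bounds (w1 ++ x :: inv_letter x :: w2) k -> bounds (w1 ++ w2) k.
Proof.
move=> [l [si [s [/map_cat_inv[s1 [s2 [-> <-]]]]]]].
case: s2 => [//|d [//|d' s2]] /= [ld ld' <-].
rewrite -ld in ld'; move=> /glued_cancel/(_ ld')[si' G].
by exists l, si', (s1 ++ s2); rewrite map_cat.
Qed.

Lemma bounds_insert w1 x w2 k : size (w1 ++ w2) + 2 <= #|D| ->
  bounds (w1 ++ w2) k -> bounds (w1 ++ x :: inv_letter x :: w2) k.
Proof.
move=> sz [l [si [s [E G]]]].
have [us si_out siK si_l le] := G.
have [d [d' [ndd' ds d's]]] : exists d d', [/\ d != d', d \notin s & d' \notin s].
  have : 1 < #|[predC s]|.
    by rewrite -(leq_add2l #|s|) cardC (card_uniqP us) -(size_map l) E.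
  by move=> /card_gt1P[d [d' [h1 h2 h3]]]; exists d, d'.
have [s1 [s2 [Es E1 E2]]] := map_cat_inv E; subst s.
pose l' z := if z == d then x else if z == d' then inv_letter x else l z.
have l'E z : z \in s1 ++ s2 -> l' z = l z.
  move=> zs; rewrite /l'; case: eqP => [zd|_]; first by rewrite -zd zs in ds.
  by case: eqP => [zd|_]; first by rewrite -zd zs in d's.
have l'd : l' d = x by rewrite /l' eqxx.
have l'd' : l' d' = inv_letter x by rewrite /l' eq_sym (negPf ndd') eqxx.
have sid := si_out d ds; have sid' := si_out d' d's.
have nS z : (z \in s1 ++ d :: d' :: s2) = [|| z == d, z == d' | z \in s1 ++ s2].
  by rewrite !mem_cat !inE; do 4!case: (_ \in _) || case: (_ == _).
have si_in z : z \in s1 ++ s2 -> si z \in s1 ++ s2.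
  by move=> zs; apply/negPn/negP => h; have := si_out _ h; rewrite siK => e; rewrite -e zs in h.
have sid1 : (tperm d d' * si)%g d = d' by rewrite permM tpermL.
have sid1' : (tperm d d' * si)%g d' = d by rewrite permM tpermR.
have siE z : z \in s1 ++ s2 -> (tperm d d' * si)%g z = si z.
  by move=> zs; rewrite permM tpermD //; [apply: contraNneq ds | apply: contraNneq d's] => ->.
exists l', (tperm d d' * si)%g, (s1 ++ d :: d' :: s2); split.
  rewrite map_cat /= l'd l'd' -E1 -E2; congr (_ ++ [:: _, _ & _]);
  by apply/eq_in_map => z zs; rewrite l'E // mem_cat zs ?orbT.
have us' : uniq (d :: d' :: s2 ++ s1).
  rewrite /= inE negb_or ndd' !(mem_cat, orbC (_ \in s2)) -!mem_cat ds d's /=.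
  by rewrite uniq_catC.
have us1 : uniq (s1 ++ d :: d' :: s2) by rewrite uniq_catC.
split=> //.
- move=> z; rewrite nS !negb_or => /and3P[zd zd' zs].
  by rewrite permM tpermD ?si_out // eq_sym.
- move=> z; case: (boolP (z \in s1 ++ s2)) => zs.
    by rewrite !siE ?siK // si_in.
  have [->|zd] := eqVneq z d; first by rewrite sid1 sid1'.
  have [->|zd'] := eqVneq z d'; first by rewrite sid1' sid1.
  have tz : (tperm d d' * si)%g z = z.
    by rewrite permM tpermD ?si_out // eq_sym.
  by rewrite !tz.
- move=> z; rewrite nS => /or3P[/eqP->|/eqP->|zs].
  + by rewrite sid1 l'd l'd'.
  + by rewrite sid1' l'd l'd' inv_letterK.
  by rewrite siE // !l'E ?si_in // si_l.
rewrite (cyc_rot_pair us1).2.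
have -> : size (s1 ++ d :: d' :: s2) = size (d :: d' :: s2 ++ s1).
  by rewrite /= !size_cat /=; lia.
rewrite nvert_pair //; last first.
  by move=> z zs; apply: si_out; rewrite mem_cat orbC -mem_cat.
have us21 : uniq (s2 ++ s1) by rewrite uniq_catC.
by rewrite (cyc_rot us21) size_cat (addnC (size s2)) -size_cat.
Qed.

Definition inv_word (w : seq (A * bool)) := rev (map (@inv_letter A) w).

Lemma bounds_insert_word w1 w w2 k : size (w1 ++ w ++ inv_word w ++ w2) <= #|D| ->
  bounds (w1 ++ w2) k -> bounds (w1 ++ w ++ inv_word w ++ w2) k.
Proof.
elim: w w1 w2 => [//|x w IH] w1 w2 sz B.
rewrite /inv_word /= rev_cons cat_rcons -cat_rcons.
apply: IH; last first.
  rewrite cat_rcons; apply: bounds_insert => //.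
  by move: sz; rewrite !size_cat /= /inv_word size_rev size_map /=; lia.
move: sz; rewrite /inv_word !(size_cat, size_rev, size_map, size_rcons) /=; lia.
Qed.

(** Exchanging two blocks loses at most two vertices: the cost of a handle. *)
Lemma bounds_swap w1 w w' w2 k : bounds (w1 ++ w ++ w' ++ w2) k ->
  bounds (w1 ++ w' ++ w ++ w2) k.+2.
Proof.
move=> [l [si [s [/map_cat_inv[s1 [s' [-> <- ]]]]]]].
move=> /map_cat_inv[t [s'' [-> <-]]] /map_cat_inv[t' [s2 [-> <- <-]]].
move=> [us si_out siK si_l le].
have pm : perm_eq (s1 ++ t' ++ t ++ s2) (s1 ++ t ++ t' ++ s2).
  by rewrite perm_cat2l perm_catCA.
exists l, si, (s1 ++ t' ++ t ++ s2); split; first by rewrite !map_cat.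
split=> //.
- by rewrite (perm_uniq pm).
- by move=> d; rewrite (perm_mem pm); apply: si_out.
- by move=> d; rewrite (perm_mem pm); apply: si_l.
have us' : uniq (s1 ++ t' ++ t ++ s2) by rewrite (perm_uniq pm).
have us2 : uniq (t ++ t' ++ s2 ++ s1) by move: us; rewrite uniq_catC -!catA.
have := cyc_swap si us2.
move: le; rewrite (cyc_rot us) (cyc_rot us') -!catA (perm_size pm) /nvert => le' h.
apply: leq_trans le' _; rewrite addnAC [leqRHS]addnAC leq_add2r -!doubleD leq_double.
by rewrite !addnS -!addSn leq_add2r.
Qed.

Definition commutator_word (w w' : seq (A * bool)) :=
  w ++ w' ++ inv_word w ++ inv_word w'.

(** A commutator arises from [a a^-1 b b^-1], whose insertion is free, by swapping [a^-1] and [b],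
    at cost 2. *)
Lemma bounds_commutators (ws : seq (seq (A * bool) * seq (A * bool)))
    (x0 : A * bool) :
  let w := flatten [seq commutator_word v.1 v.2 | v <- ws] in
  size w <= #|D| -> bounds w (size ws).*2.
Proof.
elim/last_ind: ws => [|ws v IH] /=; first by move=> _; exact: bounds_nil.
rewrite map_rcons flatten_rcons size_rcons /commutator_word => sz.
set w := flatten _ in IH sz *; rewrite doubleS.
have szI (w' : seq (A * bool)) : size (inv_word w') = size w' by rewrite size_rev size_map.
rewrite -[inv_word v.2]cats0.
rewrite (catA w v.1); apply: bounds_swap; rewrite -catA.
have -> : w ++ v.1 ++ inv_word v.1 ++ v.2 ++ inv_word v.2 ++ [::] =
  (w ++ v.1 ++ inv_word v.1) ++ v.2 ++ inv_word v.2 ++ [::] by rewrite -!catA.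
apply: bounds_insert_word.
  by move: sz; rewrite !size_cat /= !szI; lia.
rewrite cats0 -[inv_word v.1]cats0; apply: bounds_insert_word.
  by move: sz; rewrite !size_cat /= !szI; lia.
by rewrite cats0; apply: IH; apply: leq_trans sz; rewrite size_cat leq_addr.
Qed.

Lemma not_reduced w : ~~ reduced w ->
  exists w1 x w2, w = w1 ++ x :: inv_letter x :: w2.
Proof.
elim: w => [//|x w IH]; case: w IH => [//|y w] IH.
have -> : reduced [:: x, y & w] = (y != inv_letter x) && reduced (y :: w) by [].
rewrite negb_and negbK => /orP[/eqP->|/IH[w1 [z [w2 ->]]]].
  by exists [::], x, w.
by exists (x :: w1), z, w2.
Qed.

(** The last clause transports any property stable under cancellation; it serves to retain the value
    of the word in the group. *)
Lemma bounds_reduced w k : bounds w k ->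
  exists w', [/\ reduced w', bounds w' k &
    forall P : seq (A * bool) -> Prop,
      (forall w1 x w2, P (w1 ++ x :: inv_letter x :: w2) -> P (w1 ++ w2)) ->
      P w -> P w'].
Proof.
move: {2}(size w).+1 (ltnSn (size w)) => n; elim: n w => // n IH w wn B.
have [rw|/not_reduced[w1 [x [w2 Ew]]]] := boolP (reduced w).
  by exists w; split.
rewrite Ew in B wn *.
have [||w' [rw' B' h]] := IH (w1 ++ w2).
- by move: wn; rewrite !size_cat /=; lia.
- exact: bounds_cancel B.
by exists w'; split=> // P hP Pw; apply: h => //; apply: hP Pw.
Qed.

End Gluing.

Lemma nth_flatten_nseq (T : Type) (x0 : T) (s : seq T) n i : i < n * size s ->
  nth x0 (flatten (nseq n s)) i = nth x0 s (i %% size s).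
Proof.
elim: n i => [//|n IH] i; rewrite mulSn /= nth_cat => le_i.
case: ltnP => [lt|ge]; first by rewrite modn_small.
by rewrite IH; [rewrite -{2}(subnK ge) modnDr | rewrite ltn_subLR].
Qed.

(** A boundary reading the [n]-th power of [u] is capped by one face covering the relator [n] times,
    with positions taken modulo [L]. Its bound on vertices per side passes to the extremal
    surface. *)
Lemma bounds_tight (A : eqType) (L : nat) (u : L.-tuple (A * bool)) (D : finType) n k :
  cyclically_reduced u -> 0 < L -> 0 < n -> bounds D (flatten (nseq n (tval u))) k ->
  exists (D' : finType) (p' : D' -> 'I_L) (si' ph' : {perm D'}),
    [/\ tight u p' si' ph', 0 < #|D'| &
      #|D'| * (n * L) <= (nvert si' ph').*2 * (n * L) + k.*2 * #|D'|].
Proof.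
move=> u_red L_gt0 n_gt0 [l [si [s [ls [us si_out siK si_l le]]]]].
have sz : size s = n * L.
  by rewrite -(size_map l) ls size_flatten /shape map_nseq size_tuple sumn_nseq mulnC.
pose p d := Ordinal (ltn_pmod (index d s) L_gt0).
have lE d : d \in s -> tnth u (p d) = l d.
  move=> ds; have x0 := l d; rewrite (tnth_nth x0) /=.
  have := @nth_flatten_nseq _ x0 u n (index d s).
  rewrite size_tuple -sz index_mem ds -ls => /(_ isT) <-.
  by rewrite (nth_map d) ?index_mem // nth_index.
have si_in d : d \in s -> si d \in s.
  by move=> ds; apply/negPn/negP => h; have := si_out _ h; rewrite siK => e; rewrite -e ds in h.
have sf : surface_on u [set d in s] p si (cyc s).
  split=> // d; rewrite inE => ds; first by rewrite si_out // cyc_out.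
    have is_ : index d s < size s by rewrite index_mem.
    have nL : (index d s).+1 %% size s < size s.
      by rewrite ltn_pmod // sz muln_gt0 n_gt0.
    apply: val_inj; rewrite /= -{1}(nth_index d ds) cyc_nth // index_uniq //.
    by rewrite sz modn_dvdm ?dvdn_mull // -addn1 -modnDml addn1.
  by rewrite !lE ?si_in // si_l.
have Ss : #|[set d in s]| = n * L by rewrite cardsE (card_uniqP us).
have [|D' [p' [si' [ph' [tg D'_gt0 max]]]]] := tight_exists u_red sf.
  by rewrite Ss muln_gt0 n_gt0.
exists D', p', si', ph'; split=> //; rewrite Ss in max.
(* When the subtraction defining [v] would truncate, counting alone gives [n * L <= k.*2], which
   suffices. *)
case: (leqP #|D| (nvert si (cyc s) + n * L)) => [leD|ltD].
  have := max _ (eq_leq (subnK leD)); rewrite sz in le.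
  set v := _ - #|D|; have : n * L <= v.*2 + k.*2 by rewrite /v; lia.
  move=> h1 h2; have := leq_mul h1 (leqnn #|D'|); rewrite -!mul2n in h2 *; nia.
have : n * L <= k.*2 by rewrite sz in le; lia.
by move=> h; have := leq_mul h (leqnn #|D'|); nia.
Qed.

(** * Paths and folds in graphs *)

Section GraphPaths.
Variable G : graph.
Implicit Types (u v w : gV G) (p q : seq (gE G * bool)) (x : gE G * bool).

Lemma terminus_inv x : terminus (inv_letter x) = origin x.
Proof. by rewrite /terminus inv_letterK. Qed.

Lemma is_path_cat u v p q :
  is_path u v (p ++ q) <-> exists w, is_path u w p /\ is_path w v q.
Proof.
elim: p u => [|x p IH] u /=; first by split=> [h|[_ [-> //]]]; exists u.
split=> [[ux /IH[w [h1 h2]]]|[w [[ux h1] h2]]]; first by exists w.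
by split=> //; apply/IH; exists w.
Qed.

Lemma is_path_inv u v p : is_path u v p -> is_path v u (inv_word p).
Proof.
elim: p u => [|x p IH] u /=; first by [].
move=> [<- /IH h]; rewrite /inv_word /= rev_cons -cats1.
by apply/is_path_cat; exists (terminus x); rewrite /= terminus_inv.
Qed.

Lemma homotopic_congr u v u' v' p q r1 r2 : homotopic u v p q ->
  is_path u' u r1 -> is_path v v' r2 ->
  homotopic u' v' (r1 ++ p ++ r2) (r1 ++ q ++ r2).
Proof.
move=> h h1 h2; elim: h => [{}p {}q|{}p|{}p {}q _ IH|p1 p2 p3 _ IH1 _ IH2].
- move=> [pp pq [q1 [q2 [x [Ep Eq]]]]]; apply: rst_step; split.
  + by apply/is_path_cat; exists u; split=> //; apply/is_path_cat; exists v.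
  + by apply/is_path_cat; exists u; split=> //; apply/is_path_cat; exists v.
  by exists (r1 ++ q1), (q2 ++ r2), x; rewrite Ep Eq -!catA.
- exact: rst_refl.
- exact: rst_sym.
exact: rst_trans IH1 IH2.
Qed.

Lemma homotopic_inv u v p : is_path u v p -> homotopic u u (p ++ inv_word p) [::].
Proof.
elim: p u => [|x p IH] u /=; first by move=> _; apply: rst_refl.
move=> [<- pp]; rewrite /inv_word /= rev_cons -cats1 catA -[x :: _]/([:: x] ++ _).
have /= := homotopic_congr (IH _ pp) (r1 := [:: x]) (u' := origin x)
  (r2 := [:: inv_letter x]) (v' := origin x).
move=> H; apply: rst_trans; first by apply: H; rewrite /= ?terminus_inv.
apply: rst_sym; apply: rst_step; split=> //=; first by rewrite terminus_inv.
by exists [::], [::], x.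
Qed.

Lemma homotopic_cancel u v p q : is_path u v p -> is_path u v q ->
  homotopic u u (p ++ inv_word q) [::] -> homotopic u v p q.
Proof.
move=> pp pq h; have pi := is_path_inv pq.
have h1 := homotopic_congr h (r1 := [::]) (r2 := q) erefl pq.
have h2 := homotopic_inv pi.
have inv2 : inv_word (inv_word q) = q.
  rewrite /inv_word map_rev revK -map_comp -[RHS]map_id.
  by apply: eq_map => x /=; rewrite inv_letterK.
rewrite inv2 in h2.
have /= h3 := homotopic_congr h2 (r1 := p) (r2 := [::]) pp erefl.
rewrite !cats0 in h3; apply: rst_trans (rst_sym _ _ _ _ h3) _.
by move: h1; rewrite /= -catA.
Qed.

Lemma homotopic_reduced u v p : is_path u v p ->
  exists q, [/\ is_path u v q, homotopic u v p q & reduced q].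
Proof.
move: {2}(size p).+1 (ltnSn (size p)) => n; elim: n p => // n IH p pn pp.
have [rp|/not_reduced[w1 [x [w2 Ep]]]] := boolP (reduced p).
  by exists p; split=> //; apply: rst_refl.
have pp' : is_path u v (w1 ++ w2).
  move: pp; rewrite Ep => /is_path_cat[w [h1 /= [h2 [h3]]]].
  rewrite terminus_inv h2 => h4; apply/is_path_cat; by exists w.
have [|q [pq hq rq]] := IH _ _ pp'.
  by move: pn; rewrite Ep !size_cat /=; lia.
exists q; split=> //; apply: rst_trans hq; apply: rst_sym; apply: rst_step.
by split=> //; exists w1, w2, x.
Qed.
End GraphPaths.

(** * Stallings folds *)

Section Folding.

Lemma finite_composition_rcons (P : forall G H : graph, hom G H -> Prop)
    (G H K : graph) (f : hom G H) (q : hom H K) :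
  finite_composition P f -> P H K q -> finite_composition P (comp_hom q f).
Proof.
move=> fc; elim: fc K q => {G H f} [G f fid|G H K q g f Pq _ IH fE] M q' Pq'.
  apply: (composition_cons (g := id_hom M)) Pq' _ _.
    exact: composition_nil.
  by case: fid => fV fE; split=> x /=; rewrite ?fV ?fE.
apply: (composition_cons Pq (IH _ _ Pq')).
by case: fE => fV fE; split=> x /=; rewrite ?fV ?fE.
Qed.

Section Fold.
Variables (H R : graph) (p : hom H R) (e1 e2 : gE H) (a b : gV H).
Hypothesis ne : e1 <> e2.
Hypothesis adj : src e1 = src e2 \/ tgt e1 = tgt e2.
Hypothesis pe : hE p e1 = hE p e2.
Hypothesis ab : (src e1 = src e2 /\ a = tgt e1 /\ b = tgt e2) \/
  (tgt e1 = tgt e2 /\ a = src e1 /\ b = src e2).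

Let fV v := if v == b then a else v.
Let fE e := if e == e2 then e1 else e.
Let VT : finType := {v | fV v == v}.
Let ET : finType := {e | fE e == e}.

Let fVP v : fV (fV v) == fV v.
Proof. by rewrite /fV; case: (eqVneq v b) => /= [_|/negPf->]; rewrite ?if_same. Qed.

Let fEP e : fE (fE e) == fE e.
Proof. by rewrite /fE; case: (eqVneq e e2) => /= [_|/negPf->]; rewrite ?if_same. Qed.

Let qV v : VT := exist _ (fV v) (fVP v).
Let qE e : ET := exist _ (fE e) (fEP e).

Let fold_graph : graph := @Graph VT ET (fun e => qV (src (val e))) (fun e => qV (tgt (val e))).

Let fVab : fV a = fV b.
Proof. by rewrite /fV eqxx if_same. Qed.

Let pab : hV p a = hV p b.
Proof. by case: ab => -[_ [-> ->]]; rewrite -?hom_tgt -?hom_src pe. Qed.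

Let pfV v : hV p (fV v) = hV p v.
Proof. by rewrite /fV; case: eqP => // ->. Qed.

Let pfE e : hE p (fE e) = hE p e.
Proof. by rewrite /fE; case: eqP => // ->. Qed.

Let src12 : fV (src e1) = fV (src e2).
Proof. by case: ab => -[E [Ea Eb]]; rewrite ?E // -Ea -Eb. Qed.

Let tgt12 : fV (tgt e1) = fV (tgt e2).
Proof. by case: ab => -[E [Ea Eb]]; rewrite ?E // -Ea -Eb. Qed.

Let q_src e : src (g := fold_graph) (qE e) = qV (src e).
Proof. by apply: val_inj; rewrite /= /fE; case: eqP => // ->. Qed.

Let q_tgt e : tgt (g := fold_graph) (qE e) = qV (tgt e).
Proof. by apply: val_inj; rewrite /= /fE; case: eqP => // ->. Qed.

Let q : hom H fold_graph := Hom q_src q_tgt.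

Let p'V (v : VT) := hV p (val v).
Let p'E (e : ET) := hE p (val e).

Let p'_src (e : gE fold_graph) : src (p'E e) = p'V (src e).
Proof. by rewrite /p'V /= pfV hom_src. Qed.

Let p'_tgt (e : gE fold_graph) : tgt (p'E e) = p'V (tgt e).
Proof. by rewrite /p'V /= pfV hom_tgt. Qed.

Let p' : hom fold_graph R := @Hom fold_graph R p'V p'E p'_src p'_tgt.

(** The folded graph lives on the fixed points of the retractions sending [b] to [a] and [e2] to
    [e1], where [a] and [b] are the far ends of the two edges. The lost edge makes repeated folding
    terminate. *)
Lemma fold_exists : exists (H' : graph) (q : hom H H') (p' : hom H' R),
  [/\ is_fold q, hom_eq p (comp_hom p' q),
      (forall y, exists x, hV q x = y) /\ (forall y, exists x, hE q x = y),
      #|gE H'| < #|gE H| &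
      forall x y, hV q x = hV q y -> [\/ x = y, x = a /\ y = b | x = b /\ y = a]].
Proof.
have fV_eq x y : fV x = fV y <-> [\/ x = y, x = a /\ y = b | x = b /\ y = a].
  split=> [|[->|[-> ->]|[-> ->]]]; rewrite ?fVab //.
  rewrite /fV; case: (eqVneq x b) => [->|nx]; case: (eqVneq y b) => [->|ny] e.
  - exact: Or31.
  - exact: Or33.
  - exact: Or32.
  exact: Or31.
have fE_eq x y : fE x = fE y <-> [\/ x = y, x = e1 /\ y = e2 | x = e2 /\ y = e1].
  split=> [|[->|[-> ->]|[-> ->]]]; rewrite /fE ?eqxx //; last 2 first.
  - by rewrite if_same.
  - by rewrite if_same.
  case: (eqVneq x e2) => [->|nx]; case: (eqVneq y e2) => [->|ny] e.
  - exact: Or31.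
  - exact: Or33.
  - exact: Or32.
  exact: Or31.
have qV_surj (y : gV fold_graph) : exists x, hV q x = y.
  by exists (val y); apply: val_inj; rewrite /= (eqP (valP y)).
have qE_surj (y : gE fold_graph) : exists x, hE q x = y.
  by exists (val y); apply: val_inj; rewrite /= (eqP (valP y)).
exists fold_graph, q, p'; split=> //.
- exists e1, e2; split=> // x y.
    rewrite -fE_eq; split=> [/(congr1 val)//|h]; exact: val_inj.
  have -> : hV q x = hV q y <-> fV x = fV y.
    by split=> [/(congr1 val)//|h]; exact: val_inj.
  rewrite fV_eq; case: ab => -[E [-> ->]]; rewrite E; split.
  + case=> [->|h|[h1 h2]]; [exact: Or31|by apply: Or33; left|].
    by apply: Or33; right; split.
  + case=> [->|[[-> ->]|[-> ->]]|[h|[h1 h2]]]; try exact: Or31.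
      exact: Or32.
    exact: Or33.
  + case=> [->|h|[h1 h2]]; [exact: Or31|by apply: Or32; left|].
    by apply: Or32; right; split.
  + case=> [->|[h|[h1 h2]]|[[-> ->]|[-> ->]]]; try exact: Or31.
      exact: Or32.
    exact: Or33.
- by split=> x /=; rewrite /p'V /p'E /= ?pfV ?pfE.
- rewrite /= card_sig; apply: proper_card; apply/properP; split.
    by apply/fintype.subsetP.
  exists e2 => //; rewrite inE /fE eqxx; exact/eqP.
by move=> x y /(congr1 val) /fV_eq.
Qed.
End Fold.

(* Stallings' factorization. Vertices identified by the folds are joined by a
   path with trivial image; [E] stands for this relation. *)
Lemma stallings_folding (G R : graph) (f : hom G R) (E : gV G -> gV G -> Prop) :
  (forall x, E x x) -> (forall x y, E x y -> E y x) ->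
  (forall x y z, E x y -> E y z -> E x z) ->
  (forall a b, hE f a = hE f b -> E (src a) (src b) -> E (tgt a) (tgt b)) ->
  (forall a b, hE f a = hE f b -> E (tgt a) (tgt b) -> E (src a) (src b)) ->
  exists (H : graph) (q : hom G H) (p : hom H R),
    [/\ hom_eq f (comp_hom p q), finite_composition is_fold q, immersion p &
        forall x y, hV q x = hV q y -> E x y].
Proof.
move=> Er Es Et Est Ets.
suff main n (H : graph) (q : hom G H) (p : hom H R) : #|gE H| < n ->
    hom_eq f (comp_hom p q) -> finite_composition is_fold q ->
    (forall y, exists x, hV q x = y) -> (forall y, exists x, hE q x = y) ->
    (forall x y, hV q x = hV q y -> E x y) ->
  exists (H : graph) (q : hom G H) (p : hom H R),
    [/\ hom_eq f (comp_hom p q), finite_composition is_fold q, immersion p &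
        forall x y, hV q x = hV q y -> E x y].
  apply: (main #|gE G|.+1 G (id_hom G) f) => //.
  - exact: composition_nil.
  - by move=> y; exists y.
  - by move=> y; exists y.
  by move=> x y /= ->.
elim: n H q p => // n IH H q p Hn fpq fc qV qE qEq.
have [imm|] := EM (immersion p); first by exists H, q, p.
move=> nimm; have [e1 [e2 [ne adj pe]]] : exists e1 e2, [/\ e1 <> e2,
    src e1 = src e2 \/ tgt e1 = tgt e2 & hE p e1 = hE p e2].
  apply: contrapT => h; apply: nimm => e1 e2 ne adj pe.
  by apply: h; exists e1, e2.
have [a1 Ea1] := qE e1; have [a2 Ea2] := qE e2.
have fa : hE f a1 = hE f a2 by rewrite !fpq.2 /= Ea1 Ea2.
(* [E] crosses the fold: the edges [a1] and [a2] have equal images and related near ends, hence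
   related far ends. *)
have [a [b [ab Eab]]] : exists a b, ((src e1 = src e2 /\ a = tgt e1 /\ b = tgt e2) \/
  (tgt e1 = tgt e2 /\ a = src e1 /\ b = src e2)) /\
   forall x y, hV q x = a -> hV q y = b -> E x y.
  case: adj => adj.
    exists (tgt e1), (tgt e2); split; first by left.
    move=> x y; rewrite -Ea1 -Ea2 !hom_tgt => /qEq xa /qEq yb.
    apply: (Et _ _ _ xa); apply: (Et _ _ _ _ (Es _ _ yb)); apply: Est => //.
    by apply: qEq; rewrite -!hom_src Ea1 Ea2.
  exists (src e1), (src e2); split; first by right.
  move=> x y; rewrite -Ea1 -Ea2 !hom_src => /qEq xa /qEq yb.
  apply: (Et _ _ _ xa); apply: (Et _ _ _ _ (Es _ _ yb)); apply: Ets => //.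
  by apply: qEq; rewrite -!hom_tgt Ea1 Ea2.
have [H' [q' [p' [fold pq' [sV sE] lt q'eq]]]] := fold_exists ne adj pe ab.
apply: (IH H' (comp_hom q' q) p').
- exact: leq_trans lt Hn.
- by case: fpq pq' => fV fE [pV pE]; split=> x; rewrite ?fV ?fE /= ?pV ?pE.
- exact: finite_composition_rcons.
- by move=> y; have [z <-] := sV y; have [x <-] := qV z; exists x.
- by move=> y; have [z <-] := sE y; have [x <-] := qE z; exists x.
move=> x y /= /q'eq[/qEq//|[xa yb]|[xb ya]]; first exact: Eab.
by apply: Es; apply: Eab.
Qed.
End Folding.

(** * The complex of an extremal surface *)

Section CycleGraph.
Variables (T : finType) (sg : T -> bool) (nx pr : T -> T).
Hypotheses (nxK : cancel nx pr) (prK : cancel pr nx).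

Definition cycle_graph : graph := @Graph T T
  (fun t => if sg t then t else nx t) (fun t => if sg t then nx t else t).

Lemma cycle_origin (x : gE cycle_graph * bool) (v : gV cycle_graph) :
  (origin x == v) = (x == (v, sg v)) || (x == (pr v, ~~ sg (pr v))).
Proof.
have nxv (t v' : T) : (nx t == v') = (t == pr v').
  by apply/eqP/eqP => [<-|->]; rewrite ?nxK ?prK.
case: x => t b; rewrite !xpair_eqE /origin /=.
have -> : (t == v) && (b == sg v) = (t == v) && (b == sg t).
  by case: eqP => [->|].
have -> : (t == pr v) && (b == ~~ sg (pr v)) = (t == pr v) && (b == ~~ sg t).
  by case: eqP => [->|].
by case: b; case: (sg t); rewrite ?nxv ?andbT ?andbF ?orbF.
Qed.

Lemma cycle_ends_neq v : (v, sg v) != (pr v, ~~ sg (pr v)).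
Proof. by apply/eqP => -[<-]; case: (sg v). Qed.

Lemma cycle_edge_ends (v : gV cycle_graph) :
  edge_ends v = [set (v, sg v); (pr v, ~~ sg (pr v))].
Proof. by apply/setP=> x; rewrite !inE cycle_origin. Qed.

Lemma cycle_graph_cycles : union_of_cycles cycle_graph.
Proof. by move=> v; rewrite /valence cycle_edge_ends cards2 cycle_ends_neq. Qed.

Lemma cycle_adjacent (v : gV cycle_graph) : adjacent v (nx v).
Proof.
apply/existsP; exists (v, sg v); rewrite /terminus /origin /=.
by case: (sg v); rewrite !eqxx.
Qed.
End CycleGraph.

Section SurfaceComplex.
Variables (A : finType) (L : nat) (u : L.-tuple (A * bool)).
Hypothesis u_red : cyclically_reduced u.
Variables (D : finType) (p : D -> 'I_L) (si ph : {perm D}).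
Hypothesis tg : tight u p si ph.
Variable d0 : D.

Let psi : {perm D} := (si * ph)%g.
Let sgn d := (lab u p d).2.

Let siK d : si (si d) = d. Proof. by case: tg => -[]. Qed.
Let pS d : p (ph d) = ordS (p d). Proof. by case: tg => -[]. Qed.
Let lab_si d : lab u p (si d) = inv_letter (lab u p d).
Proof. by case: tg => -[_ _ h] _; apply: h. Qed.
Let sgn_si d : sgn (si d) = ~~ sgn d.
Proof. by rewrite /sgn lab_si. Qed.
Let psi_si d : psi (si d) = ph d.
Proof. by rewrite permM siK. Qed.

Let lab_psi d : lab u p (psi d) <> lab u p d.
Proof.
rewrite /lab permM pS => e; apply: (@u_red (p (si d))).
by rewrite e -/(lab u p (si d)) lab_si inv_letterK.
Qed.

Let psi_neq d : psi d != d.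
Proof. by apply/eqP => e; have := @lab_psi d; rewrite e. Qed.

Definition surface_vertex : finType := {O : {set D} | O \in porbits psi}.
Definition surface_edge : finType := {d : D | sgn d}.

Definition vx (d : D) : surface_vertex :=
  exist _ (porbit psi d) (imset_f (porbit psi) (isT : d \in D)).

Lemma vxE d e : (vx d == vx e) = (d \in porbit psi e).
Proof. by rewrite -eq_porbit_mem. Qed.

Lemma vx_psi d : vx (psi d) = vx d.
Proof. by apply: val_inj; rewrite /= porbit_step. Qed.

Lemma vx_si d : vx (si d) = vx (ph d).
Proof. by rewrite -psi_si vx_psi. Qed.

Lemma vx_surj (v : surface_vertex) : exists d, v = vx d.
Proof. by case: v => O OP; have /imsetP[d _ e] := OP; exists d; apply: val_inj. Qed.

Definition skel_graph : graph :=
  @Graph surface_vertex surface_edge (fun e => vx (val e)) (fun e => vx (si (val e))).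

(* The sides of the surface are identified with the oriented edges [(e, b)] of
   its 1-skeleton. *)
Definition side (x : gE skel_graph * bool) : D :=
  if x.2 then val x.1 else si (val x.1).

Lemma pos_side d : sgn (if sgn d then d else si d).
Proof. by case E: (sgn d) => //; rewrite sgn_si E. Qed.

Definition edge_of d : surface_edge := exist _ (if sgn d then d else si d) (pos_side d).
Definition end_of d : gE skel_graph * bool := (edge_of d, sgn d).

Lemma edge_of_si d : edge_of (si d) = edge_of d.
Proof. by apply: val_inj; rewrite /= sgn_si siK; case: (sgn d). Qed.

Lemma end_ofK d : side (end_of d) = d.
Proof. by rewrite /side /=; case: (sgn d); rewrite ?siK. Qed.

Lemma sgn_side x : sgn (side x) = x.2.
Proof.
case: x => e b; rewrite /side /=; have h := valP e.
by case: b; rewrite ?sgn_si h.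
Qed.

Lemma sideK x : end_of (side x) = x.
Proof.
rewrite /end_of sgn_side; case: x => e b; congr (_, _).
apply: val_inj; rewrite /= sgn_side /side /=.
by case: b; rewrite ?siK.
Qed.

Lemma side_inv x : side (inv_letter x) = si (side x).
Proof. by case: x => e []; rewrite /side /= ?siK. Qed.

Lemma origin_side (x : gE skel_graph * bool) : origin x = vx (side x).
Proof. by case: x => e []. Qed.

Lemma terminus_side (x : gE skel_graph * bool) : terminus x = vx (si (side x)).
Proof. by rewrite /terminus origin_side side_inv. Qed.

Definition face_graph : graph := cycle_graph sgn ph.

Lemma surface_attach_src (d : gE face_graph) : src (edge_of d : gE skel_graph) = vx (src d).
Proof. by rewrite /=; case: (sgn d) => //; rewrite vx_si. Qed.

Lemma surface_attach_tgt (d : gE face_graph) : tgt (edge_of d : gE skel_graph) = vx (tgt d).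
Proof. by rewrite /=; case: (sgn d); rewrite ?siK ?vx_si. Qed.

Definition surface_attach : hom face_graph skel_graph :=
  @Hom face_graph skel_graph vx edge_of surface_attach_src surface_attach_tgt.

Lemma edge_of_eq d e : edge_of d = edge_of e -> d = e \/ d = si e.
Proof.
move=> /(congr1 val) /=; case: (sgn d) (sgn e) => -[] E.
- by left.
- by right.
- by right; rewrite -E siK.
by left; apply: (@perm_inj _ si).
Qed.

(** Two distinct sides with the same image are opposite; a common end would give a fixed point of
    the rotation [psi], against cyclic reducedness. *)
Lemma surface_attach_immersion : immersion surface_attach.
Proof.
move=> d e ne adj /edge_of_eq[//|E].
have Es : sgn d = ~~ sgn e by rewrite E sgn_si.
move: adj; rewrite /= Es; case: (sgn e) => /=; rewrite E.
- case=> [h|h].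
    by have := psi_neq e; rewrite permM h eqxx.
  by have := psi_neq (si e); rewrite psi_si -h eqxx.
case=> [h|h].
  by have := psi_neq (si e); rewrite psi_si -h eqxx.
by have := psi_neq e; rewrite permM h eqxx.
Qed.

Lemma phK : cancel ph (ph^-1)%g. Proof. exact: permK. Qed.
Lemma phVK : cancel (ph^-1)%g ph. Proof. exact: permKV. Qed.

Definition surface_complex : complex :=
  @Complex skel_graph face_graph surface_attach (ex_intro _ (vx d0) I)
    (cycle_graph_cycles phK phVK) surface_attach_immersion.

Let X := presentation_complex u_red.

Definition to_rose : hom skel_graph (rose A) :=
  @Hom skel_graph (rose A) (fun=> tt) (fun e => (lab u p (val e)).1)
    (fun=> erefl) (fun=> erefl).

Lemma to_face_src (d : gE face_graph) :
  src (p d : gE (word_cycle u)) = p (src d).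
Proof. by rewrite /= /sgn /lab; case: (tnth _ _).2. Qed.

Lemma to_face_tgt (d : gE face_graph) :
  tgt (p d : gE (word_cycle u)) = p (tgt d).
Proof. by rewrite /= /sgn /lab; case: (tnth _ _).2. Qed.

Definition to_face : hom face_graph (word_cycle u) :=
  @Hom face_graph (word_cycle u) p p to_face_src to_face_tgt.

Lemma to_X_comm : hom_eq (comp_hom (word_attach u) to_face)
  (comp_hom to_rose surface_attach).
Proof.
split=> d //=; rewrite -/(lab u p d); case: (sgn d) => //.
by rewrite lab_si.
Qed.

Let sgn_p d e : p d = p e -> sgn d = sgn e.
Proof. by rewrite /sgn /lab => ->. Qed.

Let p_phV d : p ((ph^-1)%g d) = ord_pred (p d).
Proof. by apply: (can_inj (@ordSK L)); rewrite -pS permKV ord_predK. Qed.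

Lemma to_face_covering : covering to_face.
Proof.
move=> v y; rewrite inE => yv.
have E x : x \in edge_ends (v : gV face_graph) ->
    x = (v, sgn v) \/ x = ((ph^-1)%g v, ~~ sgn ((ph^-1)%g v)).
  by rewrite inE (cycle_origin phK phVK) => /orP[/eqP|/eqP]; [left|right].
have in1 : (v, sgn v) \in edge_ends (v : gV face_graph).
  by rewrite inE (cycle_origin phK phVK) eqxx.
have in2 : ((ph^-1)%g v, ~~ sgn ((ph^-1)%g v)) \in edge_ends (v : gV face_graph).
  by rewrite inE (cycle_origin phK phVK) eqxx orbT.
move: yv; rewrite (cycle_origin (sg := fun i => (tnth u i).2) (@ordSK L) (@ord_predK L)).
case/orP=> /eqP->.
  exists (v, sgn v); split; first by split.
  move=> x [/E[->//|->]]; rewrite /hom_end /= => -[e].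
  by rewrite (sgn_p e) -/(lab u p v) -/(sgn v); case: (sgn v).
exists ((ph^-1)%g v, ~~ sgn ((ph^-1)%g v)); split.
  by split=> //; rewrite /hom_end /= -p_phV.
move=> x [/E[->|->//]]; rewrite /hom_end /= -p_phV => -[e].
rewrite -(sgn_p e) {1}/sgn /lab e.
rewrite -/(lab u p ((ph^-1)%g v)) -/(sgn ((ph^-1)%g v)).
by case: (sgn _).
Qed.

Definition surface_map : cmorphism surface_complex X :=
  @CMorphism surface_complex X to_rose to_face to_X_comm to_face_covering.

Lemma card_surface_vertex : #|surface_vertex| = nvert si ph.
Proof. by rewrite card_sig; apply: eq_card => O. Qed.

Lemma card_surface_edge : #|surface_edge|.*2 = #|D|.
Proof.
rewrite card_sig -addnn -[RHS](cardC sgn); congr (_ + _).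
rewrite -(card_imset _ (@perm_inj _ si)); apply: eq_card => d.
apply/imsetP/idP => [[e es ->]|sd].
  by suff: ~~ sgn (si e) by []; rewrite sgn_si negbK.
exists (si d); rewrite ?siK //.
by suff: sgn (si d) by []; rewrite sgn_si.
Qed.

Lemma surface_adjacent_sym : connect_sym (@adjacent face_graph).
Proof.
apply: sym_connect_sym => c d; apply/existsP/existsP => -[x /andP[h1 h2]];
  by exists (inv_letter x); rewrite terminus_inv h1 andbT.
Qed.

(** On each component [ph] carries the sides at position [i] bijectively to those at [ordS i], so
    all [L] positions occur equally often, as many times as the degree. *)
Lemma surface_degree : degree surface_map * L = #|D|.
Proof.
set adj := @adjacent face_graph.
have adj_ph (d : D) : connect adj d (ph d).
  by apply: connect1; exact: cycle_adjacent.
have cph c d : connect adj c (ph d) = connect adj c d.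
  apply/idP/idP => h; apply: connect_trans h _ => //.
  by rewrite surface_adjacent_sym.
pose n c i := #|[set d : D | connect adj c d & p d == i]|.
have nS c i : n c (ordS i) = n c i.
  rewrite /n -[RHS](card_imset _ (@perm_inj _ ph)); apply: eq_card => d.
  rewrite inE; apply/andP/imsetP => [[cd /eqP pd]|[e]].
    exists ((ph^-1)%g d); rewrite ?permKV // inE -cph permKV cd p_phV pd.
    by rewrite ordSK eqxx.
  by rewrite inE => /andP[ce /eqP pe] ->; rewrite cph ce pS pe eqxx.
have n_const c i j : n c i = n c j.
  have it k : n c (iter k (@ordS L) j) = n c j by elim: k => //= k <-.
  have iterE k : iter k (@ordS L) j = (j + k) %% L :> nat.
    elim: k => [|k IH]; first by rewrite addn0 modn_small.
    by rewrite iterS /= IH -addn1 modnDml addn1 addnS.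
  rewrite -(it (L - j + i)); congr n; apply: ord_inj; rewrite iterE.
  by rewrite addnA subnKC ?modnDl ?modn_small // ltnW.
rewrite /degree big_distrl /= -[RHS]sum1_card.
rewrite [RHS](partition_big (root adj) (fun c => c \in roots adj)) /=; last first.
  by move=> d _; apply: roots_root; exact: surface_adjacent_sym.
apply: eq_bigr => c rc.
have {rc} rc : root adj c = c by apply/eqP.
transitivity (\sum_(i < L) n c i).
  rewrite (eq_bigr (fun=> face_degree surface_map c)) => [|i _].
    by rewrite sum_nat_const card_ord mulnC.
  by rewrite (n_const c i (p c)); apply: eq_card => d; rewrite !inE.
rewrite (partition_big p xpredT) //=; apply: eq_bigr => i _.
rewrite /n -sum1_card; apply: eq_bigl => d; rewrite inE; congr (_ && _).
by rewrite -{2}rc [RHS]eq_sym root_connect //; exact: surface_adjacent_sym.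
Qed.

Lemma whitehead_sym (v : gV skel_graph) :
  symmetric (@whitehead_rel surface_complex v).
Proof.
move=> x y; apply/existsP/existsP => -[d /andP[dv /exists_inP[s sd /exists_inP[t td]]]];
  move=> /and3P[st sx ty]; exists d; rewrite dv; apply/exists_inP; exists t => //;
  apply/exists_inP; exists s => //; by rewrite eq_sym st sx ty.
Qed.

(** The side before [psi d] on its face is [si d], which arrives through the end where [d] leaves;
    so this corner joins the ends of [d] and [psi d]. *)
Lemma whitehead_step d :
  @whitehead_rel surface_complex (vx d) (end_of d) (end_of (psi d)).
Proof.
rewrite whitehead_sym; apply/existsP; exists (psi d).
rewrite -[hV (attach _) _]/(vx (psi d)) vx_psi eqxx.
have E : (ph^-1)%g (psi d) = si d by rewrite permM permK.
apply/exists_inP; exists (psi d, sgn (psi d)).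
  by rewrite inE (cycle_origin phK phVK) eqxx.
apply/exists_inP; exists ((ph^-1)%g (psi d), ~~ sgn ((ph^-1)%g (psi d))).
  by rewrite inE (cycle_origin phK phVK) eqxx orbT.
rewrite (cycle_ends_neq sgn (ph^-1)%g) /= E.
by rewrite /hom_end /= /end_of edge_of_si sgn_si negbK !eqxx.
Qed.

Lemma edge_ends_end (v : gV skel_graph) x : x \in edge_ends v ->
  exists2 d, x = end_of d & v = vx d.
Proof.
by rewrite inE origin_side => /eqP<-; exists (side x); rewrite ?sideK.
Qed.

Lemma end_in d : end_of d \in edge_ends (vx d : gV skel_graph).
Proof. by rewrite inE origin_side end_ofK. Qed.

Lemma end_of_inj : injective end_of.
Proof. exact: can_inj end_ofK. Qed.

(** The link of a vertex is a circle: the Whitehead graph follows the rotation [psi], and deleting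
    one end leaves an arc. Valences are at least 2 because [psi] has no fixed point, and each edge
    has two sides. *)
Lemma surface_visibly_irreducible : visibly_irreducible surface_complex.
Proof.
split=> [v|v|e|v|v z zv].
- have [d ->] := vx_surj v; move/eqP; rewrite -leqn0 leqNgt card_gt0.
  by case/negP; apply/set0Pn; exists (end_of d); exact: end_in.
- have [d ->] := vx_surj v => /eqP/cards1P[x E].
  have := psi_neq d; rewrite -(inj_eq end_of_inj).
  have := end_in d; have := end_in (psi d); rewrite vx_psi E !inE.
  by move=> /eqP-> /eqP->; rewrite eqxx.
- move=> /eqP/cards1P[x E]; have he := valP e.
  have e1 : edge_of (val e) = e by apply: val_inj; rewrite /= he.
  have : val e \in [set x] by rewrite -E inE /= e1.
  have : si (val e) \in [set x] by rewrite -E inE /= edge_of_si e1.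
  rewrite !inE => /eqP h1 /eqP h2; have := sgn_si (val e).
  by rewrite h1 h2; case: (sgn x).
- move=> x y /edge_ends_end[d -> Ev] /edge_ends_end[e -> Ev'].
  have : e \in porbit psi d by rewrite -vxE -Ev -Ev'.
  move=> /porbitP[i ->] {Ev' e}; elim: i => [|i IH]; first by rewrite expg0 perm1.
  apply: connect_trans IH _; apply: connect1; rewrite expgSr permM /=.
  have Ei : v = vx ((psi ^+ i)%g d).
    by rewrite Ev; apply/eqP; rewrite vxE porbit_sym mem_porbit.
  by rewrite {1}Ei end_in {1}Ei -vx_psi end_in Ei whitehead_step.
(* The other ends come from the iterates of [psi] at [g] of exponent strictly between 0 and [nn],
   all reached from [psi g] without meeting [g]. *)
have [g Ez Ev] := edge_ends_end zv; subst z v.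
rewrite /connected_on; set R := (X in connect X); pose nn := #|porbit psi g|.
have ug : uniq (traject psi g nn) by exact: uniq_traject_porbit.
have it_neq k : 0 < k -> k < nn -> iter k psi g != g.
  move=> k0 kn; rewrite -[X in _ != X]/(iter 0 psi g).
  rewrite -(nth_traject _ kn) -(nth_traject _ (ltn_trans k0 kn)).
  by rewrite nth_uniq ?size_traject ?(ltn_trans k0 kn) // -lt0n.
have it_vx k : vx (iter k psi g) = vx g.
  by elim: k => //= k IH; rewrite vx_psi.
have it_in k : 0 < k -> k < nn -> end_of (iter k psi g) \in edge_ends (vx g : gV skel_graph) :\ end_of g.
  by move=> k0 kn; rewrite !inE (inj_eq end_of_inj) it_neq // -(it_vx k) origin_side end_ofK eqxx.
have conn k : 0 < k -> k < nn -> connect R (end_of (psi g)) (end_of (iter k psi g)).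
  elim: k => // -[|k] IH _ kn //; apply: connect_trans (IH _ (ltnW kn)) _ => //.
  apply: connect1; rewrite /R /= -!iterS !it_in // 1?ltnW //=.
  by rewrite -(it_vx k.+1); exact: whitehead_step.
have symR : connect_sym R.
  apply: sym_connect_sym => x y; rewrite /R /= whitehead_sym.
  by rewrite andbA (andbC (x \in _)) -andbA.
have all x : x \in edge_ends (vx g : gV skel_graph) :\ end_of g -> connect R (end_of (psi g)) x.
  rewrite in_setD1 => /andP[xg /edge_ends_end[d Ex Ev]]; subst x.
  have : d \in porbit psi g by rewrite -vxE Ev.
  rewrite porbit_traject => /trajectP[k kn Ed]; rewrite Ed.
  apply: conn => //; rewrite lt0n; apply: contraNneq xg => k0.
  by rewrite Ed k0.
by move=> x y xA yA; apply: connect_trans (all y yA); rewrite symR all.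
Qed.

Lemma id_covering (G : graph) : covering (id_hom G).
Proof.
move=> v y yv; exists y; split; first by split=> //; case: (y).
by move=> x [_ <-]; case: x.
Qed.

Lemma visibly_irreducible_irreducible (Y : complex) :
  visibly_irreducible Y -> irreducible Y.
Proof.
move=> vY.
have idc : hom_eq (comp_hom (attach Y) (id_hom (faces Y)))
    (comp_hom (id_hom (skel Y)) (attach Y)) by split.
exists Y, (@CMorphism Y Y (id_hom _) (id_hom _) idc (@id_covering _)); split=> //.
  by split; exists id.
exact: composition_nil.
Qed.

Lemma surface_irreducible : irreducible surface_complex.
Proof. exact/visibly_irreducible_irreducible/surface_visibly_irreducible. Qed.
End SurfaceComplex.

(** * Values of words *)

Section FreeWords.
Variables (F : groupType) (I : eqType) (b : I -> F).
Implicit Types s t w : seq (I * bool).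

Definition letter_val (x : I * bool) : F := if x.2 then b x.1 else (b x.1)^-1%g.

Lemma word_val_nil : word_val b [::] = 1%g.
Proof. by rewrite /word_val big_nil. Qed.

Lemma word_val_cons x s : word_val b (x :: s) = (letter_val x * word_val b s)%g.
Proof. by rewrite /word_val big_cons. Qed.

Lemma word_val_cat s t : word_val b (s ++ t) = (word_val b s * word_val b t)%g.
Proof.
elim: s => [|x s IH]; first by rewrite word_val_nil mul1g.
by rewrite /= !word_val_cons IH mulgA.
Qed.

Lemma letter_val_inv x : letter_val (inv_letter x) = (letter_val x)^-1%g.
Proof. by case: x => a []; rewrite /letter_val /= ?invgK. Qed.

Lemma word_val_cancel s x t :
  word_val b (s ++ x :: inv_letter x :: t) = word_val b (s ++ t).
Proof.
by rewrite !word_val_cat !word_val_cons letter_val_inv mulKVg.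
Qed.

Lemma word_val_inv s : word_val b (inv_word s) = (word_val b s)^-1%g.
Proof.
elim: s => [|x s IH]; first by rewrite word_val_nil invg1.
rewrite /inv_word /= rev_cons -cats1 word_val_cat IH !word_val_cons.
by rewrite word_val_nil mulg1 letter_val_inv invMg.
Qed.

Hypothesis b_free : forall s, reduced s -> word_val b s = 1%g -> s = [::].

Lemma null_word_val s : word_val b s = 1%g -> null_word s.
Proof.
move: {2}(size s).+1 (ltnSn (size s)) => n; elim: n s => // n IH s sn s1.
have [rs|/not_reduced[w1 [x [w2 Es]]]] := boolP (reduced s).
  by rewrite (b_free rs s1); constructor.
move: sn s1; rewrite Es word_val_cancel => sn s1; constructor; apply: IH => //.
by move: sn; rewrite !size_cat /=; lia.
Qed.

Lemma rose_homotopic_val (A : finType) (c : A -> F) x y p q :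
  @homotopic (rose A) x y p q -> word_val c p = word_val c q.
Proof.
elim=> [{}p {}q [_ _ [w1 [w2 [z [-> ->]]]]]|//|{}p {}q _ ->//|p1 p2 p3 _ -> _ ->//].
rewrite /= /word_val !big_cat /= !big_cons; case: z => a [] /=.
  by rewrite mulKVg.
by rewrite mulKg.
Qed.
End FreeWords.

(** * Essentiality of the extremal surface *)

Section Essential.
Variables (A : finType) (L : nat) (u : L.-tuple (A * bool)).
Hypothesis u_red : cyclically_reduced u.
Variables (D : finType) (p : D -> 'I_L) (si ph : {perm D}).
Hypothesis tg : tight u p si ph.
Variable d0 : D.
Variables (F : groupType) (b : A -> F).
Hypothesis b_free : forall s, reduced s -> word_val b s = 1%g -> s = [::].

Let G := skel_graph u p si ph.
Let f : hom G (rose A) := to_rose u p si ph.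
Let val_path (q : seq (gE G * bool)) : F := word_val b (map (hom_end f) q).
Let vtx : D -> gV G := vx si ph.

Let sd : gE G * bool -> D := @side A L u D p si ph.

Lemma lab_side (x : gE G * bool) : lab u p (sd x) = hom_end f x.
Proof.
have [[_ _ lS] _] := tg.
case: x => e c; have h := valP e; rewrite /sd /side /hom_end /=; case: c.
  by move: h; case: (lab u p (val e)) => a c /= ->.
by rewrite {1}/lab lS -/(lab u p (val e)); move: h; case: (lab u p (val e)) => a c /= ->.
Qed.

Lemma vpath_side a c (q : seq (gE G * bool)) : is_path (vtx a) (vtx c) q ->
  vpath si (si * ph)%g a (map sd q) c.
Proof.
elim: q a => [|x q IH] a /=; first by move=> /eqP; rewrite vxE.
rewrite origin_side (terminus_side tg) => -[/esym/eqP + /IH ->].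
by rewrite vxE => ->.
Qed.

Lemma surface_reduced_path a c (q : seq (gE G * bool)) :
  is_path (vtx a) (vtx c) q -> reduced q -> val_path q = 1%g -> p a = p c ->
  q = [::] /\ a = c.
Proof.
move=> pq rq q1 pac.
have siE : {mono sd : x y / y != inv_letter x >-> y != si x}.
  by move=> x y; rewrite -(side_inv tg) (inj_eq (can_inj (sideK tg))).
have rs : sorted (fun x y => y != si x) (map sd q).
  rewrite sorted_map; apply: sub_sorted rq => x y /=; by rewrite -siE.
have nl : null_word (map (lab u p) (map sd q)).
  by rewrite -map_comp (eq_map lab_side); apply: null_word_val b_free _ q1.
have [q0 ac] := tight_reduced_path tg rs (vpath_side pq) nl pac.
by case: q q0 {pq rq q1 rs nl}.
Qed.

Lemma val_path_cat q q' : val_path (q ++ q') = (val_path q * val_path q')%g.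
Proof. by rewrite /val_path map_cat word_val_cat. Qed.

Lemma val_path_inv q : val_path (inv_word q) = (val_path q)^-1%g.
Proof.
rewrite /val_path -word_val_inv /inv_word map_rev -!map_comp; congr (word_val b (rev _)).
Qed.

Lemma homotopic_val x y q q' : homotopic x y q q' -> val_path q = val_path q'.
Proof.
elim=> [{}q {}q' [_ _ [w1 [w2 [z [-> ->]]]]]|//|{}q {}q' _ ->//|q1 q2 q3 _ -> _ ->//].
rewrite /val_path !map_cat /= -[hom_end f (inv_letter z)]/(inv_letter (hom_end f z)).
by rewrite word_val_cancel.
Qed.

(** Both halves of essentiality rest on this: applied to loops it gives injectivity on fundamental
    groups, and its conclusion [a = c] gives injectivity on faces. *)
Lemma surface_trivial_path a c (q : seq (gE G * bool)) :
  is_path (vtx a) (vtx c) q -> val_path q = 1%g -> p a = p c ->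
  homotopic (vtx a) (vtx c) q [::] /\ a = c.
Proof.
move=> pq q1 pac; have [q' [pq' hq rq']] := homotopic_reduced pq.
have [|q'0 ac] := surface_reduced_path pq' rq' _ pac.
  by rewrite -(homotopic_val hq).
by split=> //; rewrite -q'0.
Qed.

Lemma to_rose_pi1_injective : pi1_injective f.
Proof.
move=> v q q' pq pq' h; apply: homotopic_cancel => //.
have [a Ea] := vx_surj v; subst v.
have pqq : is_path (vtx a) (vtx a) (q ++ inv_word q').
  by apply/is_path_cat; exists (vtx a); split=> //; exact: is_path_inv.
apply: (proj1 (surface_trivial_path pqq _ erefl)).
by rewrite val_path_cat val_path_inv /val_path (rose_homotopic_val b h) mulgV.
Qed.

Let joined (x y : gV G) : Prop := exists q, is_path x y q /\ val_path q = 1%g.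

Lemma surface_map_essential : essential (surface_map u_red tg d0).
Proof.
split; last exact: to_rose_pi1_injective.
have j_refl x : joined x x by exists [::]; split=> //; exact: word_val_nil.
have j_sym x y : joined x y -> joined y x.
  move=> [q [pq q1]]; exists (inv_word q); split; first exact: is_path_inv.
  by rewrite val_path_inv q1 invg1.
have j_trans x y z : joined x y -> joined y z -> joined x z.
  move=> [q [pq q1]] [q' [pq' q'1]]; exists (q ++ q'); split.
    by apply/is_path_cat; exists y.
  by rewrite val_path_cat q1 q'1 mulg1.
have j_edge (e e' : gE G) (c : bool) : hE f e = hE f e' ->
    joined (origin (e, c)) (origin (e', c)) -> joined (terminus (e, c)) (terminus (e', c)).
  move=> fe [q [pq q1]].
  exists (inv_letter (e, c) :: q ++ [:: (e', c)]); split.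
    split; first by [].
    rewrite terminus_inv; apply/is_path_cat; exists (origin (e', c)); by split.
  rewrite -cat1s !val_path_cat q1 mul1g /val_path !word_val_cons !word_val_nil !mulg1.
  rewrite -[hom_end f (inv_letter _)]/(inv_letter (hom_end f (e, c))) letter_val_inv.
  have -> : hom_end f (e', c) = hom_end f (e, c).
    exact: (congr1 (fun h => (h, c)) (esym fe)).
  by rewrite mulVg.
have [H [q [pp [fpq fc imm qj]]]] := stallings_folding (f := f) j_refl j_sym j_trans
  (fun e e' h => j_edge e e' true h) (fun e e' h => j_edge e e' false h).
exists H, q, pp, fpq; split=> //.
(* A point of the fibre product records a folded vertex and a position: equal folded vertices give a
   path of trivial value, and equal positions then give equal sides. *)
have injV : injective (hV (fprod_map (folded_comm (f := surface_map u_red tg d0) fpq))).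
  move=> a c /(congr1 val) /= [/qj[r [pr r1]] pac].
  by have [_ ->] := surface_trivial_path pr r1 pac.
split=> // d e E.
have [sE tE] : src d = src e :> gV (face_graph u p ph) /\ tgt d = tgt e :> gV (face_graph u p ph).
  split; apply: injV; rewrite -?hom_src -?hom_tgt; by rewrite E.
have pde : p d = p e by move: E => /(congr1 val) /= [_].
(* The common sign tells whether the source or the target of each edge is the side itself. *)
move: sE tE; rewrite /= /lab pde.
by case: (tnth u (p e)).2.
Qed.
End Essential.

From mathcomp Require Import all_boot all_order all_algebra ring lra.
From mathcomp Require Import all_classical all_reals all_analysis.

Import Order.TTheory GRing.Theory Num.Theory.

(** * Words and subgroups of free groups *)

Section ReducedWords.
Variables (F : groupType) (I : eqType) (b : I -> F).
Hypothesis b_free : forall s, reduced s -> word_val b s = 1%g -> s = [::].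
Implicit Types s t : seq (I * bool).

Lemma reduced_cat_cons s x y t : reduced (s ++ x :: y :: t) =
  [&& reduced (rcons s x), y != inv_letter x & reduced (y :: t)].
Proof.
case: s => [//|z s]; rewrite /reduced /= -cat_rcons cat_path last_rcons.
by rewrite -[path _ x _]/((y != inv_letter x) && path _ y t).
Qed.

Lemma reduced_inv_word s : reduced (inv_word s) = reduced s.
Proof.
rewrite /reduced /inv_word rev_sorted sorted_map; case: s => //= x s.
by apply: eq_path => y z /=; rewrite inv_letterK eq_sym.
Qed.

Lemma reduced_unique s t : reduced s -> reduced t ->
  word_val b s = word_val b t -> s = t.
Proof.
elim: s t => [|x s IH] [|y t] rs rt e //.
- by rewrite (b_free rt) // -e word_val_nil.
- by rewrite (b_free rs) // e word_val_nil.
have red_tl z r : reduced (z :: r) -> reduced r by case: r => //= z' r /andP[].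
have [xy|nxy] := eqVneq x y.
  congr (_ :: _) => //; apply: IH; [exact: red_tl rs|exact: red_tl rt|].
  by move: e; rewrite !word_val_cons xy => /mulgI.
have : inv_word (x :: s) ++ y :: t = [::].
  apply: b_free.
    rewrite /inv_word /= rev_cons cat_rcons reduced_cat_cons -rev_cons.
    rewrite -[rev _]/(inv_word (x :: s)) reduced_inv_word rs rt inv_letterK.
    by rewrite eq_sym nxy.
  by rewrite word_val_cat word_val_inv e mulVg.
by move/(congr1 size); rewrite size_cat /= addnS.
Qed.

Lemma word_val_nseq n s : word_val b (flatten (nseq n s)) = (word_val b s ^+ n)%g.
Proof.
by elim: n => [|n IH]; rewrite ?word_val_nil //= word_val_cat IH expgS.
Qed.

Lemma cyclically_reduced_pow L (u : L.-tuple (I * bool)) n :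
  cyclically_reduced u -> reduced (flatten (nseq n (tval u))).
Proof.
move=> u_red; case: (posnP L) => [L0|L_gt0].
  subst L; rewrite (tuple0 u) /= (_ : flatten _ = [::]) //; by elim: n.
have sz : size (flatten (nseq n (tval u))) = n * L.
  by rewrite size_flatten /shape map_nseq size_tuple sumn_nseq mulnC.
have x0 := tnth u (Ordinal L_gt0); apply/(sortedP x0) => i; rewrite sz => iL.
have nthE j : j < n * L -> nth x0 (flatten (nseq n (tval u))) j =
    tnth u (Ordinal (ltn_pmod j L_gt0)).
  move=> jL; have := @nth_flatten_nseq _ x0 u n j.
  by rewrite size_tuple => /(_ jL) ->; rewrite (tnth_nth x0).
rewrite !nthE //; last exact: ltnW.
apply/eqP => /= e; case: (u_red (Ordinal (ltn_pmod i L_gt0))).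
rewrite -e; congr tnth; apply: val_inj.
by rewrite /= -addn1 modnDml addn1.
Qed.

(** A shortest word representing a conjugate works: a cyclic cancellation could be rotated to the
    front and removed. *)
Lemma cyclically_reduced_conj (w : F) : w <> 1%g -> (exists s, w = word_val b s) ->
  exists (L : nat) (u : L.-tuple (I * bool)),
    [/\ 0 < L, cyclically_reduced u & exists g, word_val b u = (w ^ g)%g].
Proof.
move=> w1 [s0 Es0].
pose P m := `[< exists s, size s = m /\ exists g, word_val b s = (w ^ g)%g >].
have exP : exists m, P m.
  by exists (size s0); apply/asboolP; exists s0; split=> //; exists 1%g; rewrite conjg1.
have [m /asboolP[s [sm [g sg]]] min] := ex_minnP exP.
have rot_conj i : word_val b (rot i s) = (w ^ (g * word_val b (take i s)))%g.
  rewrite conjgM -sg -{2}(cat_take_drop i s) /rot !word_val_cat conjgE.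
  by rewrite mulgA mulKg.
have L_gt0 : 0 < size s.
  rewrite lt0n; apply/eqP => /size0nil s_nil; apply: w1.
  by apply/eqP; rewrite -(conjg_eq1 w g) -sg s_nil word_val_nil.
exists (size s), (in_tuple s); split=> //; last by exists g.
move=> i; set x := tnth _ i => e.
have xE : x = nth x s i by rewrite {1}/x (tnth_nth x).
have eE : nth x s (i.+1 %% size s) = inv_letter x.
  by rewrite -e (tnth_nth x).
suff [r Er] : exists r, rot i s = x :: inv_letter x :: r.
  have szr : size r < m.
    by have := size_rot i s; rewrite Er /= sm => <-.
  suff : P (size r) by move=> /min; rewrite leqNgt szr.
  apply/asboolP; exists r; split=> //; exists (g * word_val b (take i s))%g.
  by rewrite -rot_conj Er -[x :: _]/([::] ++ x :: inv_letter x :: r) word_val_cancel.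
rewrite /rot (drop_nth x (ltn_ord i)) -xE.
have [lt|ge] := ltnP i.+1 (size s).
  by move: eE; rewrite modn_small // (drop_nth x lt) => ->; eexists.
have is_ : i.+1 = size s by apply/eqP; rewrite eqn_leq ge ltn_ord.
move: eE; rewrite is_ modnn drop_size => e0.
case: (posnP i) => [i0|i_gt0].
  by case: (@inv_letter_neq I x); rewrite -e0 -[in LHS]i0 -xE.
exists (behead (take i s)); rewrite cat_cons cat0s; congr (_ :: _).
rewrite -e0 -(nth_take x i_gt0); move: (size_takel (ltnW (ltn_ord i))).
by case: (take i s) => //= si0; rewrite -si0 in i_gt0.
Qed.

Lemma commutators_word (g : F) k n (w : F) :
  (forall x, exists s, x = word_val b s) ->
  product_of_commutators k (w ^+ n)%g ->
  exists ws : seq (seq (I * bool) * seq (I * bool)), size ws = k /\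
    word_val b (flatten [seq commutator_word v.1 v.2 | v <- ws]) = ((w ^ g) ^+ n)%g.
Proof.
move=> gen [x [y E]].
have [W WP] := choice gen.
(* Inverses appear because [[~ x, y]] is [x^-1 y^-1 x y], whereas [commutator_word] reads
   [a b a^-1 b^-1]. *)
exists [seq (W (x i ^ g)^-1%g, W (y i ^ g)^-1%g) | i <- index_enum 'I_k].
split; first by rewrite size_map [index_enum _]unlock -enumT size_enum_ord.
rewrite -conjXg E conjg_prod -map_comp.
elim: (index_enum _) => [|i s IH]; first by rewrite big_nil word_val_nil.
rewrite big_cons /= word_val_cat -IH; congr (_ * _)%g.
rewrite /commutator_word !word_val_cat !word_val_inv -!WP !invgK.
by rewrite conjRg commgEl conjgE !mulgA.
Qed.

End ReducedWords.

Local Open Scope ring_scope.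

(** The last inequality is tau/deg >= 1 - 2k/n without denominators. *)
Lemma essential_surface (F : groupType) (r : nat) (b : 'I_r -> F) (w : F)
    (L : nat) (u : L.-tuple ('I_r * bool)) (u_red : cyclically_reduced u)
    (n k : nat) :
  free_basis classical_sets.setT b -> (0 < L)%N -> (0 < n)%N ->
  (exists g, word_val b u = (w ^ g)%g) ->
  product_of_commutators k (w ^+ n)%g ->
  exists (Y : complex) (f : cmorphism Y (presentation_complex u_red)),
    [/\ irreducible Y, essential f, (0 < degree f)%N &
      (degree f)%:Z * n%:Z <= total_curvature f * n%:Z + (2 * k)%:Z * (degree f)%:Z].
Proof.
move=> [gen b_free] L_gt0 n_gt0 [g ug] pc.
have gen' x : exists s, x = word_val b s by apply/gen.
have [ws [wsk wsE]] := commutators_word g gen' pc.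
have x0 := tnth u (Ordinal L_gt0).
set W := flatten _ in wsE.
(* One side per letter of [W] is just enough for the insertions. *)
have B : bounds 'I_(size W) W k.*2.
  by rewrite -wsk; apply: bounds_commutators => //; rewrite card_ord.
have [W' [rW' BW' inv]] := bounds_reduced B.
(* Reduced words of equal value coincide, so the reduced boundary is literally a power of [u]. *)
have EW : W' = flatten (nseq n (tval u)).
  apply: (reduced_unique b_free) => //; first exact: cyclically_reduced_pow.
  rewrite word_val_nseq ug -wsE; apply: (inv (fun s => word_val b s = word_val b W)) => //.
  by move=> w1 x w2 <-; rewrite word_val_cancel.
rewrite EW in BW'.
have [D [p [si [ph [tg D_gt0 le]]]]] := bounds_tight u_red L_gt0 n_gt0 BW'.
have /card_gt0P[d0 _] := D_gt0.
exists (surface_complex u_red tg d0), (surface_map u_red tg d0).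
have dL := surface_degree u_red tg d0.
have eD := card_surface_edge tg.
set d := degree _ in dL *.
have d_gt0 : (0 < d)%N by rewrite -(ltn_pmul2r L_gt0) dL mul0n.
split=> //; first exact: surface_irreducible.
  exact: surface_map_essential b_free.
rewrite /total_curvature -/d /euler_char.
rewrite -[#|gE _|]/#|surface_edge u p| -[#|gV _|]/#|surface_vertex si ph| card_surface_vertex.
set V := nvert _ _ in le *; set E := #|_| in eD *.
have : (E * n <= V * n + 2 * k * d)%N.
  have le' : (E.*2 * (n * L) <= V.*2 * (n * L) + k.*2.*2 * (d * L))%N.
    by rewrite eD dL.
  rewrite -(leq_pmul2r L_gt0) -leq_double.
  apply: leq_trans (leq_trans _ le') _; rewrite -!muln2; lia.
lia.
Qed.

Local Open Scope classical_set_scope.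

(** * Reduction to finite rank *)

Section SubgroupType.
Variables (F : groupType) (S : {pred F}) (S_closed : group_closed S).

(** The proof of closure is kept in the type so that the group structure can be inferred from it. *)
Definition subgroup_type (_ : group_closed S) : Type := {x : F | x \in S}.
Local Notation H := (subgroup_type S_closed).
HB.instance Definition _ := SubChoice.on H.
HB.instance Definition _ := SubChoice_isSubGroup.Build F (mem S) H S_closed.

Lemma val_word (I : Type) (b : I -> H) s :
  val (word_val b s) = word_val (fun i => val (b i)) s.
Proof.
rewrite /word_val; elim: s => [|x s IH]; first by rewrite !big_nil.
by rewrite !big_cons valM IH; case: x.2.
Qed.

(** Rank and primitivity inside a subgroup of [H] are the same when it is seen in [F], where the
    infimum ranges over more subgroups. *)
Lemma primitivity_rank_subgroup (R : realType) (w : H) :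
  (primitivity_rank R (val w) <= primitivity_rank R w)%E.
Proof.
apply: ereal_inf_le_tmp => _ [K [n [[K1 Kd] Kw Kp [b [bg bf]] ->]]].
exists [set val x | x in K]%classic, n; split=> //.
- split; first by exists 1%g.
  move=> _ _ [x Kx <-] [y Ky <-]; exists (x * y^-1)%g; first exact: Kd.
  by rewrite valM.
- by exists w.
- move=> [I [c [[cg cf] [i ci]]]]; apply: Kp.
  have cK j : exists x, K x /\ val x = c j.
    have [x Kx xc] : [set val x | x in K]%classic (c j).
      by apply/cg; exists [:: (j, true)]; rewrite /word_val big_seq1.
    by exists x.
  have [h hP] := choice cK.
  have hE s : val (word_val h s) = word_val c s.
    by rewrite val_word; congr (word_val _ s); apply: funext => j; case: (hP j).
  exists I, h; split; last by exists i; apply: val_inj; have [_ ->] := hP i.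
  split=> [x|s rs hs]; last by apply: cf => //; rewrite -hE hs.
  split=> [Kx|[s Es]].
    have /cg[s Es] : [set val x | x in K]%classic (val x) by exists x.
    by exists s; apply: val_inj; rewrite hE.
  have [y Ky /val_inj <- //] : [set val x | x in K]%classic (val x).
  by apply/cg; exists s; rewrite -hE Es.
exists (fun i => val (b i)); split=> [x|s rs hs].
  split=> [[y Ky <-]|[s ->]].
    by have /bg[s ->] := Ky; exists s; rewrite val_word.
  by exists (word_val b s); [apply/bg; exists s|rewrite val_word].
by apply: bf => //; apply: val_inj; rewrite val_word hs.
Qed.
End SubgroupType.

Lemma word_val_map (F : groupType) (I J : Type) (b : I -> F) (c : J -> I) s :
  word_val b [seq (c x.1, x.2) | x <- s] = word_val (fun j => b (c j)) s.
Proof. by rewrite /word_val big_map. Qed.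

Section LetterSubgroup.
Variables (F : groupType) (I : eqType) (b : I -> F) (J : seq I).

(** For a free basis [b], the free factor on the letters of the finite list [J], to which the
    finite-rank hypothesis applies. *)
Definition letter_subgroup : {pred F} :=
  [pred x | `[< exists s, all (fun l => l.1 \in J) s /\ x = word_val b s >]].

Lemma letter_subgroupP x : reflect
  (exists s, all (fun l => l.1 \in J) s /\ x = word_val b s) (x \in letter_subgroup).
Proof. exact: asboolP. Qed.

Lemma letter_subgroup_closed : group_closed letter_subgroup.
Proof.
split; first by apply/letter_subgroupP; exists [::]; rewrite word_val_nil.
move=> x y /letter_subgroupP[s [sJ ->]] /letter_subgroupP[t [tJ ->]].
apply/letter_subgroupP; exists (s ++ inv_word t); split.
  by rewrite all_cat sJ /inv_word all_rev all_map.
by rewrite word_val_cat word_val_inv.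
Qed.

Let H : groupType := subgroup_type letter_subgroup_closed.

Lemma letter_in i : i \in J -> b i \in letter_subgroup.
Proof.
move=> iJ; apply/letter_subgroupP; exists [:: (i, true)]; rewrite /= iJ.
by rewrite /word_val big_seq1.
Qed.

Lemma letter_subgroup_basis : uniq J -> free_basis classical_sets.setT b ->
  exists c : 'I_(size J) -> H, free_basis classical_sets.setT c.
Proof.
move=> uJ [bg bf]; pose t := in_tuple J.
have t_inj : injective (tnth t) by apply/tuple_uniqP.
have tJ i : tnth t i \in J by exact: mem_tnth.
pose c i : H := exist _ (b (tnth t i)) (letter_in (tJ i)).
have cE s : val (word_val c s) = word_val b [seq (tnth t x.1, x.2) | x <- s].
  by rewrite val_word word_val_map.
exists c; split=> [x|s rs s1].
  split=> // _; have /letter_subgroupP[s [sJ Es]] := valP x.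
  suff [s' Es'] : exists s', s = [seq (tnth t x.1, x.2) | x <- s'].
    by exists s'; apply: val_inj; rewrite cE -Es'.
  elim: s sJ {Es} => [|[i e] s IH] /=; first by exists [::].
  move=> /andP[iJ /IH[s' ->]]; have /tnthP[k ->] : i \in t by [].
  by exists ((k, e) :: s').
have := bf [seq (tnth t x.1, x.2) | x <- s].
rewrite -cE s1 => h; have : [seq (tnth t x.1, x.2) | x <- s] = [::].
  apply: h => //; rewrite /reduced sorted_map; apply: sub_sorted rs => x y /=.
  apply: contra => /eqP[/t_inj e1 e2].
  by apply/eqP; case: x y e1 e2 => [? ?] [? ?] /= -> ->.
by case: s {rs s1 h}.
Qed.
End LetterSubgroup.

(** * Comparison of primitivity rank and stable commutator length *)

Local Open Scope ereal_scope.

Lemma finite_rank_bound (R : realType) (F : groupType) (r : nat) (b : 'I_r -> F)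
    (w : F) (n k : nat) :
  (forall (L : nat) (u : L.-tuple ('I_r * bool)) (u_red : cyclically_reduced u),
     (exists g : F, word_val b u = (w ^ g)%g) ->
     irreducible_curvature R (presentation_complex u_red)
       = 2%:E - primitivity_rank R w) ->
  free_basis classical_sets.setT b -> w <> 1%g -> (0 < n)%N ->
  product_of_commutators k (w ^+ n)%g ->
  primitivity_rank R w <= (1 + 2 * k%:R / n%:R)%:E.
Proof.
move=> curv bF w1 n_gt0 pc.
have gen x : exists s, x = word_val b s by apply/(proj1 bF).
have [L [u [L_gt0 u_red ug]]] := cyclically_reduced_conj w1 (gen w).
have [Y [f [irr ess d_gt0 le]]] := essential_surface u_red bF L_gt0 n_gt0 ug pc.
have : ((total_curvature f)%:~R / (degree f)%:R)%:E <= 2%:E - primitivity_rank R w.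
  rewrite -(curv L u u_red ug); apply: ereal_sup_ubound; by exists Y, f.
(* Rank [+oo] would bound a real ratio by [-oo]; for [-oo] the bound is trivial. *)
case: (primitivity_rank R w) => [x| |] //; last by rewrite leNye.
rewrite -EFinB !lee_fin => h.
have n0 : (0 < n%:R :> R)%R by rewrite ltr0n.
have dR : (0 < (degree f)%:R :> R)%R by rewrite ltr0n.
have leR : ((degree f)%:R * n%:R <=
    (total_curvature f)%:~R * n%:R + 2 * k%:R * (degree f)%:R :> R)%R.
  by move: le; rewrite -(ler_int R) !(intrD, intrM) /= -!pmulrn natrM.
set d : R := (degree f)%:R in h dR leR; set q : R := (k%:R / n%:R)%R.
have kq : k%:R = (q * n%:R)%R by rewrite divfK ?gt_eqF.
have : ((1 - 2 * q) * d <= (total_curvature f)%:~R :> R)%R.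
  by rewrite -(ler_pM2r n0); rewrite kq in leR; lra.
rewrite -ler_pdivlMr // -mulrA -/q; lra.
Qed.

Theorem corollary3p29 (R : realType)
  (rational_curvature : forall (F : groupType) (r : nat) (b : 'I_r -> F),
     free_basis setT b ->
     forall w : F, w <> 1%g ->
     forall (n : nat) (u : n.-tuple ('I_r * bool)) (u_red : cyclically_reduced u),
     (exists g : F, word_val b u = (w ^ g)%g) ->
     irreducible_curvature R (presentation_complex u_red)
       = 2%:E - primitivity_rank R w)
  (F : groupType) (F_free : is_free F)
  (w : F) (w_nontriv : w <> 1%g) (w_comm : commutator_subgroup w) :
  2%:E * scl R w >= primitivity_rank R w - 1%:E.
Proof.
have bound n k : (0 < n)%N -> product_of_commutators k (w ^+ n)%g ->
    primitivity_rank R w <= (1 + 2 * k%:R / n%:R)%:E.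
  move=> n_gt0 [x [y E]]; have [I [b bF]] := F_free.
  have gen z : exists s, z = word_val b s by apply/(proj1 bF).
  have [W WP] := choice gen.
  (* Finitely many letters express [w] and the entries of the commutators, so the identity for
     [w ^+ n] already holds in a free factor of finite rank. *)
  pose J := undup (flatten [seq [seq l.1 | l <- W z] |
    z <- w :: [seq x i | i <- enum 'I_k] ++ [seq y i | i <- enum 'I_k]]).
  have inJ z : z \in w :: [seq x i | i <- enum 'I_k] ++ [seq y i | i <- enum 'I_k] ->
      z \in letter_subgroup b J.
    move=> zs; apply/letter_subgroupP; exists (W z); split=> //.
    apply/allP => l lW; rewrite mem_undup; apply/flattenP.
    by exists [seq l.1 | l <- W z]; [apply/mapP; exists z | exact: (map_f fst)].
  have wJ : w \in letter_subgroup b J by apply: inJ; rewrite mem_head.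
  have xJ i : x i \in letter_subgroup b J.
    by apply: inJ; rewrite inE mem_cat map_f ?orbT // mem_enum.
  have yJ i : y i \in letter_subgroup b J.
    by apply: inJ; rewrite inE mem_cat orbC map_f ?orbT // mem_enum.
  pose H : groupType := subgroup_type (letter_subgroup_closed b J).
  pose w' : H := exist _ w wJ.
  pose x' i : H := exist _ (x i) (xJ i); pose y' i : H := exist _ (y i) (yJ i).
  have [c cF] := letter_subgroup_basis (J := J) (undup_uniq _) bF.
  have pc' : product_of_commutators k (w' ^+ n)%g.
    exists x', y'; apply: val_inj.
    have -> : val (w' ^+ n)%g = (w ^+ n)%g.
      by elim: (n) => [//|m IH]; rewrite !expgS valM IH.
    rewrite E; elim: (index_enum _) => [|i s IH]; first by rewrite !big_nil.
    by rewrite !big_cons valM IH; congr (_ * _)%g; rewrite !commgEl !conjgE !valM.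
  apply: le_trans (primitivity_rank_subgroup R w') _.
  have w'1 : w' <> 1%g by move/(congr1 val).
  exact: (finite_rank_bound (rational_curvature H _ c cF w' w'1) cF w'1 n_gt0 pc').
(* Both infima, in [cl] and in [scl], are unfolded at once. *)
have scl_ge (y : \bar R) : (forall n k, (0 < n)%N ->
    product_of_commutators k (w ^+ n)%g -> y * n%:R%:E <= k%:R%:E) -> y <= scl R w.
  move=> h; apply/ereal_infP => _ [n [n_gt0 ->]].
  have n0 : (0 < n%:R :> R)%R by rewrite ltr0n.
  have -> : y = y * n%:R%:E * (n%:R^-1)%:E.
    by rewrite -muleA -EFinM mulfV ?mule1 // gt_eqF.
  apply: lee_wpmul2r.
    by rewrite lee_fin invr_ge0 ltW.
  by apply/ereal_infP => _ [k [pc ->]]; exact: h.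
case Ep : (primitivity_rank R w) => [x| |]; last by rewrite leNye.
- have : ((x - 1) / 2)%:E <= scl R w.
    apply: scl_ge => n k n_gt0 /(bound n k n_gt0).
    have n0 : (0 < n%:R :> R)%R by rewrite ltr0n.
    rewrite Ep !lee_fin -mulrA => le_x; rewrite -[leRHS](divfK (lt0r_neq0 n0)) ler_pM2r //; lra.
  move=> /(lee_wpmul2l (x := 2%:E)); rewrite lee_fin => /(_ (ler0n _ _)).
  apply: le_trans; rewrite -EFinB -EFinM lee_fin; lra.
(* Here the primitivity rank is infinite, and [bound] excludes every expression of a power of [w] as
   a product of commutators. *)
have -> : scl R w = +oo.
  apply/eqP; rewrite -leye_eq; apply: scl_ge => n k n_gt0 /(bound n k n_gt0).
  by rewrite Ep.
by rewrite gt0_muley ?lte_fin // leey.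
Qed.
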